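(* Let $\mathcal{A}$ be a finite alphabet and let $\eta\colon\mathbb{Z}^2\to\mathcal{A}$. Assume that there exists $n\in\mathbb{N}$ such that $P_{\eta}(n,3)\leq 3n$. Then $\eta$ is periodic.
   Context: $\mathbb{N}=\{1,2,3,\dots\}$. A map $\eta\colon\mathbb{Z}^2\to\mathcal{A}$ is periodic if there exists $\vec m\in\mathbb{Z}^2$, $\vec m\neq\vec 0$, such that $\eta(\vec x+\vec m)=\eta(\vec x)$ for all $\vec x\in\mathbb{Z}^2$. The rectangular complexity $P_\eta(n,k)$ is the number of distinct $n$ by $k$ rectangular patterns occurring in $\eta$: with $R_{n,k}=\{0,\dots,n-1\}\times\{0,\dots,k-1\}$, $P_\eta(n,k)$ is the number of distinct functions $R_{n,k}\to\mathcal{A}$ of the form $\vec x\mapsto\eta(\vec x+\vec u)$ with $\vec u\in\mathbb{Z}^2$. *)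

(* Defs.v *)
From mathcomp Require Import all_boot all_order all_algebra.
From mathcomp Require Import boolp.

Set Implicit Arguments.
Unset Strict Implicit.
Unset Printing Implicit Defensive.

Import GRing.Theory.

Local Open Scope ring_scope.

Definition periodic (A : Type) (eta : int * int -> A) : Prop :=
  exists m : int * int, m != 0 /\ forall x : int * int, eta (x + m) = eta x.

(* The rectangle R_{n,k} is the finite type 'I_n * 'I_k; its points are embedded
   in Z^2 by the cast from nat to int. *)
Definition rect_pattern (A : finType) (eta : int * int -> A) (n k : nat)
    (u : int * int) : {ffun 'I_n * 'I_k -> A} :=
  [ffun x : 'I_n * 'I_k => eta (((x.1 : nat)%:Z, (x.2 : nat)%:Z) + u)].

(* u ranges over the infinite type Z^2, hence the classical truth value
   `[< _ >] instead of a boolean quantifier. *)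
Definition rect_complexity (A : finType) (eta : int * int -> A) (n k : nat)
    : nat :=
  #|[set f : {ffun 'I_n * 'I_k -> A} |
      `[< exists u : int * int, f = rect_pattern eta n k u >]]|.

(* Main.v *)
(* Read the letters as integers and a Laurent polynomial as a difference operator on functions Z^2 -> C.
   A complexity of at most nk forces a nonzero f, supported in the n x k rectangle, with f eta constant.
   - F = (X - 1) f annihilates eta. Frobenius modulo large primes shows that so does F(X^m, Y^m) for every m = 1 + ir,
     for a suitable r; eliminating all monomials of F but one from these relations gives an annihilator prod (X^{w_j} - 1), which over
     the algebraic numbers splits into factors X^d - z with d primitive.
   - Let Phi be a shortest product of such factors with Phi eta doubly periodic. If all the directions d are parallel,
     eta is periodic. Every g with g eta doubly periodic is a multiple of Phi, because a finite-valued function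
     satisfying a nontrivial linear recurrence is periodic. So the g supported in the rectangle form a space of
     dimension at most T, the number of translates of the bounding box of Phi inside the rectangle.
   - If two factors X^d - z and X^e - y of Phi are not parallel, let h and h' be Phi eta with the one, respectively the
     other, of these factors removed. A product of suitable translates of h and h' has no nonzero annihilator at all, as
     on a sublattice it is b(j) c(i) with b, c finite-valued and aperiodic. Its T translates that are visible in the
     rectangle are therefore linearly independent modulo the affine functions of the nk letters, which span
     a space of dimension at least nk + 1 - T. Hence there are at least nk + 1 patterns. *)

Require Import Defs.
From mathcomp Require Import all_boot all_order all_algebra.
From mathcomp Require Import all_field.
From mathcomp Require Import boolp zify ring.

Set Implicit Arguments.
Unset Strict Implicit.
Unset Printing Implicit Defensive.

Import Order.TTheory GRing.Theory Num.Theory.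

Local Open Scope ring_scope.

Notation vec := (int * int)%type.

(** * Finite-valued sequences and functions *)

(** Pigeonhole on the states (window of [m] letters, position mod [N]). The period depends only on
    [s], [m] and [N], so it serves all lines of a planar function at once. *)
Lemma deterministic_periodic (T : eqType) (s : seq T) (m N : nat) : (0 < N)%N ->
  exists2 S : nat, (0 < S)%N &
  forall b : int -> T, (forall j, b j \in s) ->
  (forall j j' : int, (N %| j' - j)%Z ->
     (forall i : nat, (i < m)%N -> b (j + i%:Z) = b (j' + i%:Z)) ->
     b (j + m%:Z) = b (j' + m%:Z)) ->
  forall j, b (j + S%:Z) = b j.
Proof.
move=> N0.
pose st := (m.-tuple 'I_(size s).+1 * 'I_N)%type.
pose S := #|{: st}|.
(* Each sequence repeats a state after some [p <= S] steps, and every such [p] divides the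
   factorial. *)
exists S`!; first exact: fact_gt0.
move=> b bs det j.
have stP (k : int) : exists f : st,
   (forall i : 'I_m, (tnth f.1 i : nat) = index (b (k + (i : nat)%:Z)) s)
   /\ (f.2 : nat)%:Z = (k %% N%:Z)%Z.
  have hk : (`|(k %% N%:Z)%Z| < N)%N by lia.
  exists ([tuple inord (index (b (k + (i : nat)%:Z)) s) | i < m], Ordinal hk); split.
    move=> i; rewrite tnth_mktuple inordK // ltnS index_size //.
  rewrite /=; lia.
have [F hF] := choice stP.
(* Starting [S] places before [j] puts the first of the two equal states at or before [j], so
   determinism in the forward direction suffices. *)
pose j0 : int := j - S%:Z.
have : ~~ injectiveb (fun i : 'I_S.+1 => F (j0 + (i : nat)%:Z)).
  apply/negP => /injectiveP inj.
  have := leq_card _ inj; rewrite card_ord -/S; lia.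
case/injectivePn => i1 [i2 ne eF].
wlog lt12 : i1 i2 ne eF / (i1 < i2)%N.
  move=> H; case: (ltngtP i1 i2) => [l|l|e].
  - exact: (H i1 i2).
  - by apply: (H i2 i1) => //; rewrite eq_sym.
  - by move: ne; rewrite (val_inj e) eqxx.
pose p := (i2 - i1)%N.
have p0 : (0 < p)%N by rewrite subn_gt0.
have pS : (p <= S)%N by rewrite /p; have := ltn_ord i2; lia.
have per : forall k : nat, b (j0 + (i1 : nat)%:Z + k%:Z + p%:Z) = b (j0 + (i1 : nat)%:Z + k%:Z).
  have [h1 h1'] := hF (j0 + (i1 : nat)%:Z); have [h2 h2'] := hF (j0 + (i2 : nat)%:Z).
  have pE : j0 + (i2 : nat)%:Z = j0 + (i1 : nat)%:Z + p%:Z by rewrite /p; lia.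
  have dvd : (N %| p%:Z)%Z.
    have e : ((j0 + (i1 : nat)%:Z) %% N)%Z = ((j0 + (i2 : nat)%:Z) %% N)%Z.
      by rewrite -h1' -h2' eF.
    by move/eqP: e; rewrite eq_sym pE eqz_mod_dvd addrC addKr.
  elim/ltn_ind => k IH.
  case: (ltnP k m) => km.
    have := h2 (Ordinal km); rewrite -eF h1 /= => e.
    have := congr1 (nth (b 0) s) e; rewrite !nth_index // => ->; congr b; lia.
  have -> : j0 + (i1 : nat)%:Z + k%:Z = (j0 + (i1 : nat)%:Z + (k - m)%N%:Z) + m%:Z by lia.
  rewrite addrAC; apply/esym/det.
    by match goal with |- is_true (_ %| ?x)%Z => have -> : x = p%:Z by lia end.
  move=> i im; have := IH (k - m + i)%N; rewrite -[RHS]/(b _).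
  move=> /(_ ltac:(lia)) e.
  apply/esym; transitivity (b (j0 + i1%:Z + (k - m + i)%N%:Z + p%:Z)); first by congr b; lia.
  by rewrite e; congr b; lia.
have dv : (p %| S`!)%N by apply: dvdn_fact; rewrite p0.
have per' : forall q k : nat, b (j0 + (i1 : nat)%:Z + k%:Z + (q * p)%N%:Z) = b (j0 + (i1 : nat)%:Z + k%:Z).
  elim=> [|q IH] k; first by rewrite mul0n addr0.
  rewrite -[RHS]per; transitivity (b (j0 + (i1 : nat)%:Z + (k + p)%N%:Z)).
    by rewrite -IH; congr b; lia.
  by congr b; lia.
have i1S : (i1 <= S)%N by have := ltn_ord i1; lia.
have := per' (S`! %/ p)%N (S - i1)%N; rewrite divnK //.
have -> : j0 + (i1 : nat)%:Z + (S - i1)%N%:Z = j by rewrite /j0; lia.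
by [].
Qed.

Lemma vec_mulz (d : vec) (j : int) : d *~ j = (d.1 * j, d.2 * j).
Proof. by case: d => x y; rewrite [LHS]surjective_pairing !(raddfMz fst, raddfMz snd) /= !mulrzz. Qed.

Lemma vec_muln (d : vec) (n : nat) : d *+ n = (d.1 * n%:Z, d.2 * n%:Z).
Proof. by rewrite pmulrn vec_mulz. Qed.

Lemma vec_add (a b c d : int) : (a, b) + (c, d) = (a + c, b + d).
Proof. by []. Qed.

Definition cross (d e : vec) : int := d.1 * e.2 - d.2 * e.1.

Section FiniteValued.
Variable F : fieldType.
Implicit Types (w h : vec -> F) (d t u : vec) (x : vec * F).

Definition fin_valued w := exists s : seq F, forall t, w t \in s.

Definition per_along d w := exists2 N : nat, (0 < N)%N & forall t, w (t + d *+ N) = w t.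

Definition doubly_per w := exists2 N : nat, (0 < N)%N & forall t u, w (t + u *+ N) = w t.

(* [x = (d, z)] acts as the operator [X^d - z]. *)
Definition twist x w t : F := w (t + x.1) - x.2 * w t.

Lemma fin_valued_twist w x : fin_valued w -> fin_valued (twist x w).
Proof.
case=> s hs; exists [seq a - x.2 * b | a <- s, b <- s] => t.
by apply/allpairsP; exists (w (t + x.1), w t); rewrite !hs.
Qed.

Lemma per_along_mulz d w N : (forall t, w (t + d *+ N) = w t) ->
  forall (j : int) t, w (t + d *~ (j * N%:Z)) = w t.
Proof.
move=> per; have pn (j : nat) t : w (t + d *~ (j%:Z * N%:Z)) = w t.
  elim: j t => [|j IH] t; first by rewrite mul0r mulr0z addr0.
  rewrite -[RHS]IH -[RHS]per; congr w; rewrite pmulrn -addrA -mulrzDr; congr (_ + _ *~ _); lia.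
case=> j t; first exact: pn.
by rewrite -[LHS](pn j.+1); congr w; rewrite -addrA -mulrzDr NegzE mulNr addNr mulr0z addr0.
Qed.

Lemma doubly_per_mulz w N : (forall t u, w (t + u *+ N) = w t) ->
  forall (j : int) t u, w (t + u *~ (j * N%:Z)) = w t.
Proof. by move=> per j t u; apply: per_along_mulz => t'; apply: per. Qed.

Lemma doubly_per_along d w : doubly_per w -> per_along d w.
Proof. by case=> N N0 per; exists N. Qed.

Lemma per_along_doubly d e w : cross d e != 0 ->
  per_along d w -> per_along e w -> doubly_per w.
Proof.
move=> D0 [N N0 pd] [M M0 pe]; exists (N * M * `|cross d e|)%N; first by rewrite !muln_gt0 N0 M0 absz_gt0.
move=> t u; pose s := Num.sg (cross d e).
have sE : (`|cross d e|%N)%:Z = s * cross d e by rewrite /s abszE -normrEsg.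
(* Cramer's rule: the multiple of [u] by the determinant is an integer combination of [d] and
   [e]. *)
have -> : t + u *+ (N * M * `|cross d e|) =
  t + d *~ (s * (u.1 * e.2 - u.2 * e.1) * M%:Z * N%:Z) + e *~ (s * (u.2 * d.1 - u.1 * d.2) * N%:Z * M%:Z).
  rewrite vec_muln !vec_mulz -addrA; congr (_ + _); rewrite !PoszM sE /cross.
  by rewrite vec_add; congr (_, _) => /=; ring.
by rewrite per_along_mulz // per_along_mulz.
Qed.

Lemma per_along_parallel d e w : cross d e = 0 -> d != 0 ->
  per_along d w -> per_along e w.
Proof.
case: d => x y; case: e => x' y'; rewrite /cross /= => D0 d0 [N N0 pd].
have key (j i : int) : i != 0 -> (x', y') *~ i = (x, y) *~ j -> per_along (x', y') w.
  move=> i0 e; exists (N * `|i|)%N; first by rewrite muln_gt0 N0 absz_gt0.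
  move=> t; have -> : (x', y') *+ (N * `|i|) = (x, y) *~ (Num.sg i * j * N%:Z).
    have iE : (`|i|%N)%:Z = i * Num.sg i by rewrite mulrC abszE -normrEsg.
    by rewrite pmulrn PoszM iE mulrC -!mulrA mulrzA e -mulrzA; congr (_ *~ _); ring.
  exact: per_along_mulz.
have [x0|x0] := eqVneq x 0; last first.
  by apply: (key x' x) => //; rewrite !vec_mulz /=; congr (_, _); lia.
apply: (key y' y); first by apply: contra_neq d0; rewrite x0 => ->.
by rewrite !vec_mulz /=; congr (_, _); lia.
Qed.

Lemma doubly_per_common w w' : doubly_per w -> doubly_per w' ->
  exists2 N : nat, (0 < N)%N & (forall t u, w (t + u *+ N) = w t) /\ (forall t u, w' (t + u *+ N) = w' t).
Proof.
move=> [N N0 p] [M M0 q]; exists (N * M)%N; first by rewrite muln_gt0 N0.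
by split=> t u; [rewrite mulnC mulrnA p | rewrite mulrnA q].
Qed.

Lemma doubly_per_add w w' : doubly_per w -> doubly_per w' -> doubly_per (fun t => w t + w' t).
Proof. by move=> h h'; have [N N0 [p q]] := doubly_per_common h h'; exists N => // t u; rewrite p q. Qed.

Lemma doubly_per_scale w a : doubly_per w -> doubly_per (fun t => a * w t).
Proof. by case=> N N0 p; exists N => // t u; rewrite p. Qed.

Lemma doubly_per_opp w : doubly_per w -> doubly_per (fun t => - w t).
Proof. by case=> N N0 p; exists N => // t u; rewrite p. Qed.

Lemma doubly_per_shift w v : doubly_per w -> doubly_per (fun t => w (t + v)).
Proof. by case=> N N0 p; exists N => // t u; rewrite addrAC p. Qed.

Lemma doubly_per_const a : doubly_per (fun=> a).
Proof. by exists 1%N. Qed.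

Lemma doubly_per_sum (I : Type) (r : seq I) (f : I -> vec -> F) :
  (forall i, doubly_per (f i)) -> doubly_per (fun t => \sum_(i <- r) f i t).
Proof.
move=> h; elim: r => [|i r IH]; first by apply: eq_ind (doubly_per_const 0) _ _; apply/funext => t; rewrite big_nil.
have -> : (fun t => \sum_(j <- i :: r) f j t) = (fun t => f i t + \sum_(j <- r) f j t).
  by apply/funext => t; rewrite big_cons.
exact: doubly_per_add.
Qed.

Lemma doubly_per_twist w x : doubly_per w -> doubly_per (twist x w).
Proof.
move=> h; apply: doubly_per_add; first exact: doubly_per_shift.
by apply/doubly_per_opp/doubly_per_scale.
Qed.

(** On each line in direction [d] the next value is [z] times the current one plus a periodic term,
    so the current value and the position modulo [M] determine it. *)
Lemma twist_per_along h d e z : cross d e = 0 -> d != 0 -> fin_valued h ->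
  per_along e (twist (d, z) h) -> e != 0 -> per_along d h.
Proof.
move=> D0 d0 [s hs] pe e0.
have [|M M0 pd] := per_along_parallel (e := d) _ e0 pe; first by move: D0; rewrite /cross; lia.
have [S S0 HS] := deterministic_periodic s 1 M0.
exists S => // t.
have := HS (fun j => h (t + d *~ j)) (fun j => hs _) _ 0; rewrite mulr0z addr0 add0r -pmulrn; apply.
move=> j j' dv /(_ 0%N isT); rewrite !addr0 => e1.
have step k : h (t + d *~ (k + 1%:Z)) = twist (d, z) h (t + d *~ k) + z * h (t + d *~ k).
  by rewrite /twist /= subrK mulrzDr mulr1z addrA.
rewrite !step e1; congr (_ + _).
case/dvdzP: dv => q dq; have -> : j' = j + q * M%:Z by lia.
by rewrite mulrzDr addrA per_along_mulz.
Qed.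

End FiniteValued.

Lemma seq_argmax (T : eqType) (f : T -> int) (s : seq T) x0 : x0 \in s ->
  exists2 x, x \in s & forall y, y \in s -> f y <= f x.
Proof.
elim: s x0 => // a s IH x0 _; case: s IH => [|b s] IH.
  by exists a => [|y]; rewrite ?inE // => /eqP ->.
have [x xs hx] := IH b (mem_head _ _).
case: (leP (f a) (f x)) => h.
  by exists x => [|y]; rewrite inE ?xs ?orbT // => /orP[/eqP -> //|/hx].
exists a => [|y]; first exact: mem_head.
by rewrite inE => /orP[/eqP -> //|/hx /le_trans -> //]; apply: ltW.
Qed.

(** * Linear recurrences of finite-valued sequences *)

Section Recurrence.
Variable F : fieldType.

(** The term of strictly largest offset can be solved for, so the preceding [m] letters and the
    residue mod [N] determine the next letter; [m] is the spread of the offsets. *)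
Lemma recurrence_periodic (I : eqType) (s : seq F) (r : seq I) (c : I -> F) (o : I -> int) (i0 : I) (N : nat) :
  uniq r -> i0 \in r -> c i0 != 0 -> (0 < N)%N ->
  (forall i, i \in r -> i != i0 -> c i != 0 -> o i < o i0) ->
  exists2 S : nat, (0 < S)%N & forall (b e : int -> F), (forall j, b j \in s) ->
    (forall j k, e (j + k * N%:Z) = e j) ->
    (forall j, \sum_(i <- r) c i * b (j + o i) = e j) -> forall j, b (j + S%:Z) = b j.
Proof.
move=> Ur ri0 ci0 N0 omax.
have [i1 _ h1] := seq_argmax (fun i => - o i) ri0.
pose m := (`|o i0 - o i1|%N).
have [S S0 HS] := deterministic_periodic s m N0.
exists S => // b e bs eper rec; apply: HS => // j j' dv bE.
have step k : b (k + m%:Z) = (c i0)^-1 * (e (k + m%:Z - o i0) -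
    \sum_(i <- r | i != i0) c i * b (k + m%:Z - o i0 + o i)).
  by rewrite -rec (bigD1_seq i0) //= addrK subrK mulKf.
rewrite !step; congr (_ * (_ - _)).
  case/dvdzP: dv => q dq; rewrite -[RHS](eper _ (- q)); congr e; lia.
rewrite big_seq_cond [RHS]big_seq_cond; apply: eq_bigr => i /andP[ri ne].
have [->|ci] := eqVneq (c i) 0; first by rewrite !mul0r.
have lt := omax i ri ne ci; have le := h1 i ri.
pose q := absz (m%:Z - o i0 + o i).
have qE : q%:Z = m%:Z - o i0 + o i by rewrite /q /m; lia.
have qm : (q < m)%N by lia.
have := bE q qm; rewrite qE !addrA => bb; congr (_ * _); exact: bb.
Qed.

(** After grouping equal offsets, a surviving coefficient would give a recurrence with a unique
    leading term, hence a period. *)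
Lemma shifts_independent (I : eqType) (b : int -> F) (s : seq F) (r : seq I) (c : I -> F) (o : I -> int) :
  (forall j, b j \in s) -> (forall S : nat, (0 < S)%N -> exists j, b (j + S%:Z) != b j) ->
  (forall j, \sum_(i <- r) c i * b (j + o i) = 0) ->
  forall z, \sum_(i <- r | o i == z) c i = 0.
Proof.
move=> bs np rec z.
pose c' y := \sum_(i <- r | o i == y) c i.
pose r' := undup (map o r).
have rec' j : \sum_(y <- r') c' y * b (j + y) = 0.
  rewrite -[RHS](rec j) /c'; under eq_bigr do rewrite mulr_suml.
  rewrite (eq_bigr (fun y => \sum_(i <- r) (if o i == y then c i * b (j + y) else 0))); last first.
    by move=> y _; rewrite big_mkcond.
  rewrite exchange_big /= big_seq [RHS]big_seq; apply: eq_bigr => i ri.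
  rewrite (bigD1_seq (o i)) ?undup_uniq //=; last by rewrite mem_undup map_f.
  rewrite eqxx big1 ?addr0 // => y ne; by rewrite eq_sym (negPf ne).
have [//|nz] := eqVneq (\sum_(i <- r | o i == z) c i) 0.
have zr : z \in r'.
  rewrite mem_undup; apply: contraNT nz => nz; apply/eqP; rewrite big_seq_cond big1 // => i /andP[ri /eqP e].
  by case/negP: nz; rewrite -e map_f.
pose r1 := [seq y <- r' | c' y != 0].
have zr1 : z \in r1 by rewrite mem_filter nz zr.
have [y0 y0r hy0] := seq_argmax (fun y => y) zr1.
have y0r' : y0 \in r' by move: y0r; rewrite mem_filter => /andP[].
have cy0 : c' y0 != 0 by move: y0r; rewrite mem_filter => /andP[].
have [|S S0 HS] := @recurrence_periodic _ s r' c' id y0 1 (undup_uniq _) y0r' cy0 isT.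
  move=> i ri ne ci; rewrite lt_neqAle ne /=; apply: hy0; by rewrite mem_filter ci.
by have [j] := np S S0; rewrite (HS b (fun=> 0)) ?eqxx.
Qed.

End Recurrence.

(** * Eigenfunctions of a translation modulo doubly periodic functions *)

Section Lines.
Variable F : fieldType.
Implicit Types (w h : vec -> F) (d t u : vec) (x : vec * F).

Lemma unimodular_complement d : coprimez d.1 d.2 ->
  exists2 v, cross d v = 1 & forall u, u = v *~ cross d u + d *~ cross u v.
Proof.
case/coprimezP => [[a b] /= e]; exists (- b, a); first by rewrite /cross /=; lia.
move=> [x y]; rewrite !vec_mulz vec_add /cross /=; congr (_, _).
  transitivity (x * (a * d.1 + b * d.2)); first by rewrite e mulr1.
  by ring.
transitivity (y * (a * d.1 + b * d.2)); first by rewrite e mulr1.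
by ring.
Qed.

(** Modulo doubly periodic functions [h] is an eigenfunction of translation by [d] with eigenvalue
    [z]; negative [m] uses that [z] is invertible. *)
Lemma twist_eigen h d z m : z != 0 -> doubly_per (twist (d, z) h) ->
  doubly_per (fun t => h (t + d *~ m) - z ^ m * h t).
Proof.
move=> z0 pe; elim/int_rec: m => [|n IH|n IH].
- apply: eq_ind (doubly_per_const 0) _ _; apply/funext => t.
  by rewrite mulr0z addr0 expr0z mul1r subrr.
- apply: eq_ind (doubly_per_add (doubly_per_shift (d *~ n) pe) (doubly_per_scale z IH)) _ _.
  apply/funext => t; have -> : t + d *~ n.+1 = t + d *~ n + d by rewrite intS mulrzDr mulr1z [d + _]addrC addrA.
  have -> : z ^ n.+1%:Z = z * z ^ n%:Z by rewrite -[LHS]/(z ^+ n.+1) exprS.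
  by rewrite /twist /=; ring.
- apply: eq_ind (doubly_per_add (doubly_per_scale (- z^-1) (doubly_per_shift (d *~ (- n.+1%:Z)) pe)) (doubly_per_scale z^-1 IH)) _ _.
  apply/funext => t; rewrite /twist /=.
  have -> : t + d *~ - n.+1%:Z + d = t + d *~ - n%:Z.
    by rewrite -addrA -{2}[d]mulr1z -mulrzDr; congr (_ + _ *~ _); lia.
  have -> : z ^ (- n.+1%:Z) = z^-1 * z ^ (- n%:Z).
    by rewrite -[z^-1]exprN1 -exprzDr ?unitfE //; congr (_ ^ _); lia.
  by field.
Qed.

(** Modulo doubly periodic functions, translations along [d] are scalars, so the relation collapses
    to a recurrence in the complementary direction [v]. As the support of [a] meets each line of
    direction [d] at most once, no coefficients cancel. *)
Lemma line_recurrence h d z (rs : seq vec) (a : vec -> F) u1 :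
  coprimez d.1 d.2 -> z != 0 -> fin_valued h -> doubly_per (twist (d, z) h) ->
  uniq rs -> u1 \in rs -> a u1 != 0 ->
  {in rs &, forall u u', a u != 0 -> a u' != 0 -> cross d u = cross d u' -> u = u'} ->
  doubly_per (fun t => \sum_(u <- rs) a u * h (t + u)) -> doubly_per h.
Proof.
move=> cd z0 fh pe Urs ru1 au1 inj prec.
have [v vd dec] := unimodular_complement cd.
have d0 : d != 0 by apply/eqP => e; move: cd; rewrite e.
have [s hs] := fh.
have u1r : u1 \in [seq u <- rs | a u != 0] by rewrite mem_filter au1.
have [u0 u0r u0max] := seq_argmax (cross d) u1r.
move: u0r; rewrite mem_filter => /andP[au0 u0r].
pose c u := a u * z ^ (cross u v).
(* Trading the translation by [u] for its [v]-component costs the scalar [z ^ cross u v] and a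
   doubly periodic error. *)
have prec' : doubly_per (fun t => \sum_(u <- rs) c u * h (t + v *~ cross d u)).
  apply: eq_ind (doubly_per_add prec (doubly_per_opp (doubly_per_sum rs (f := fun u t =>
    a u * (h (t + v *~ cross d u + d *~ cross u v) - z ^ (cross u v) * h (t + v *~ cross d u))) _))) _ _.
    move=> u; apply/doubly_per_scale; exact: doubly_per_shift (twist_eigen (cross u v) z0 pe).
  apply/funext => t; rewrite -sumrB; apply: eq_bigr => u _.
  by rewrite -addrA -dec /c; ring.
case: prec' => N N0 hN.
have c0 : c u0 != 0 by rewrite mulf_neq0 // expfz_neq0.
have [|S S0 HS] := @recurrence_periodic _ _ s rs c (cross d) u0 N Urs u0r c0 N0.
  move=> u ur ne cu; have au : a u != 0 by apply: contra_neq cu; rewrite /c => ->; rewrite mul0r.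
  rewrite lt_neqAle u0max ?mem_filter ?au // andbT; apply: contra_neq ne => e.
  exact: inj.
apply: (@per_along_doubly _ d v); first by rewrite vd.
  apply: (twist_per_along (e := d) _ d0 fh (doubly_per_along _ pe) d0); rewrite /cross; lia.
exists S => // t.
have := HS (fun j => h (t + v *~ j)) (fun j => \sum_(u <- rs) c u * h (t + v *~ j + v *~ cross d u)) _ _ _ 0.
rewrite mulr0z addr0 add0r -pmulrn; apply.
- by move=> j; apply: hs.
- move=> j k; rewrite -(doubly_per_mulz hN k (t + v *~ j) v); apply: eq_bigr => u _.
  by rewrite mulrzDr addrA.
- by move=> j; apply: eq_bigr => u _; rewrite mulrzDr addrA.
Qed.

End Lines.

(** * Division of Laurent polynomials in a box *)

Definition between (a b c : int) := (a <= c <= b) || (b <= c <= a).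

(** Axis-parallel boxes, encoded by closure under spanned rectangles, so that shrinking needs no
    computation with endpoints. *)
Definition boxlike (B : pred vec) := forall p q r, B p -> B q ->
  between p.1 q.1 r.1 -> between p.2 q.2 r.2 -> B r.

Definition shrink (d : vec) (B : pred vec) : pred vec := fun t => B t && B (t + d).

Lemma boxlike_shrink d B : boxlike B -> boxlike (shrink d B).
Proof.
move=> bB p q r /andP[Bp Bpd] /andP[Bq Bqd] h1 h2; rewrite /shrink (bB p q) //=.
apply: (bB _ _ _ Bpd Bqd); rewrite /between /= ?lerD2r //.
Qed.

Lemma between_mul (x a i j : int) : 0 <= j <= i -> between x (x + a * i) (x + a * j).
Proof.
move=> /andP[j0 ji]; rewrite /between.
have [a0|a0] := leP 0 a; apply/orP; [left|right]; apply/andP; split; nia.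
Qed.

Lemma boxlike_segment B u d (i j : int) : boxlike B -> B u -> B (u + d *~ i) ->
  0 <= j <= i -> B (u + d *~ j).
Proof.
by move=> bB Bu Bi ij; apply: (bB _ _ _ Bu Bi); rewrite !vec_mulz /=; apply: between_mul.
Qed.

Lemma big_support (R : nmodType) (T : eqType) (s1 s2 : seq T) (f : T -> R) :
  uniq s1 -> uniq s2 -> (forall u, f u != 0 -> (u \in s1) = (u \in s2)) ->
  \sum_(u <- s1) f u = \sum_(u <- s2) f u.
Proof.
move=> U1 U2 e; rewrite [LHS](bigID (fun u => f u == 0)) [RHS](bigID (fun u => f u == 0)) /=.
rewrite [X in X + _ = _]big1 ?[X in _ = X + _]big1 ?add0r; try by move=> u /eqP.
rewrite -big_filter -[RHS]big_filter; apply/perm_big/uniq_perm; rewrite ?filter_uniq // => u.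
by rewrite !mem_filter; case: eqVneq => //= /e.
Qed.

Section Division.
Variable F : fieldType.
Implicit Types (w h g : vec -> F) (d t u : vec) (x : vec * F) (B : pred vec).

Fixpoint twists (P : seq (vec * F)) w := if P is x :: P' then twists P' (twist x w) else w.

(* The positions at which the bounding box of the product of the factors in [P] fits into the box [B]. *)
Fixpoint core B (P : seq (vec * F)) := if P is x :: P' then core (shrink x.1 B) P' else B.

(* Quotient of the Laurent polynomial [g], supported in [B], by [X^d - z] for [x = (d, z)]: the coefficient at [u] sums
   [z^(i-1) g(u + id)] over [i >= 1], where [N] only has to exceed the length of [B] in direction [d]. *)
Definition quot (N : nat) B x g u : F :=
  if B u then \sum_(i < N) x.2 ^+ i * g (u + x.1 *+ i.+1) else 0.

(** Remainders are dropped at each stage. The result is linear in [g], so its vanishing at a point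
    is one linear equation on [g]. *)
Fixpoint quots N B (P : seq (vec * F)) g :=
  if P is x :: P' then quots N (shrink x.1 B) P' (quot N B x g) else g.

Definition conv (rs : seq vec) g w t := \sum_(u <- rs) g u * w (t + u).

Definition admissible x := coprimez x.1.1 x.1.2 && (x.2 != 0).

(** Minimality under deletion of one factor passes to the tail of [P] when the head is applied to
    [w]. *)
Definition minimal_twists (P : seq (vec * F)) w := doubly_per (twists P w) /\
  forall P1 y P2, P = P1 ++ y :: P2 -> ~ doubly_per (twists (P1 ++ P2) w).

Lemma twistC x y w : twist x (twist y w) = twist y (twist x w).
Proof. by apply/funext => t; rewrite /twist [t + y.1 + _]addrAC; ring. Qed.

Lemma twists_twist P x w : twists P (twist x w) = twist x (twists P w).
Proof. by elim: P w => //= y P IH w; rewrite twistC IH. Qed.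

Lemma twists_cat P Q w : twists (P ++ Q) w = twists Q (twists P w).
Proof. by elim: P w => //= y P IH w; rewrite IH. Qed.

Lemma fin_valued_twists P w : fin_valued w -> fin_valued (twists P w).
Proof. by elim: P w => //= y P IH w h; apply/IH/fin_valued_twist. Qed.

Lemma doubly_per_twists P w : doubly_per w -> doubly_per (twists P w).
Proof. by elim: P w => //= y P IH w h; apply/IH/doubly_per_twist. Qed.

Lemma twists_conv rs g P w : twists P (conv rs g w) = conv rs g (twists P w).
Proof.
elim: P w => //= x P IH w; rewrite -IH; congr twists; apply/funext => t.
rewrite /twist /conv mulr_sumr -sumrB; apply: eq_bigr => u _.
by rewrite [t + x.1 + u]addrAC; ring.
Qed.

Lemma quot_linear N B x a g g' u :
  quot N B x (fun u => a * g u + g' u) u = a * quot N B x g u + quot N B x g' u.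
Proof.
rewrite /quot; case: ifP => _; last by rewrite mulr0 addr0.
rewrite mulr_sumr -big_split /=; apply: eq_bigr => i _; ring.
Qed.

Lemma quots_linear N B P a g g' u :
  quots N B P (fun u => a * g u + g' u) u = a * quots N B P g u + quots N B P g' u.
Proof.
elim: P B g g' => //= x P IH B g g'; rewrite -IH; congr (quots _ _ _ _ _).
by apply/funext => v; rewrite quot_linear.
Qed.

(** * Division by a single factor *)

Section Quotient.
Variables (rs : seq vec) (B : pred vec) (d : vec) (z : F) (g : vec -> F).
Hypotheses (Urs : uniq rs) (bB : boxlike B) (Brs : forall u, B u -> u \in rs).
Hypotheses (d0 : d != 0) (gB : forall u, g u != 0 -> B u).

Let q := quot (size rs) B (d, z) g.
(** Coefficients of the remainder [g - (X^d - z) q]. *)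
Let r u := g u - q (u - d) + z * q u.

(** Otherwise the segment from [u] to [u + d *+ i] would give more than [size rs] distinct points of
    [rs]. *)
Lemma leaves_box u i : B u -> (size rs <= i)%N -> ~~ B (u + d *+ i).
Proof.
move=> Bu si; apply/negP => Bi.
have : (size [seq (u + d *+ j)%R | j <- iota 0 i.+1] <= size rs)%N.
  apply: uniq_leq_size.
    rewrite map_inj_uniq ?iota_uniq // => j j' /addrI; rewrite !vec_muln => -[e1 e2].
    apply/eqP; apply: contraNT d0 => ne; rewrite [d]surjective_pairing; apply/eqP; congr (_, _); nia.
  move=> v /mapP[j]; rewrite mem_iota => ij ->; apply: Brs.
  have Bi' : B (u + d *~ i%:Z) by rewrite -pmulrn.
  by rewrite pmulrn; apply: (boxlike_segment bB Bu Bi'); lia.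
rewrite size_map size_iota; lia.
Qed.

Lemma quot_support u : q u != 0 -> shrink d B u.
Proof.
rewrite /q /quot; case: ifP => [Bu|]; last by rewrite eqxx.
move=> h; rewrite /shrink Bu /=.
have [i gi] : exists i : 'I_(size rs), g (u + d *+ i.+1) != 0.
  apply/existsP; apply: contraNT h => /existsPn h; apply/eqP/big1 => i _.
  by have := h i; rewrite negbK => /eqP ->; rewrite mulr0.
have := gB gi; rewrite pmulrn => Bi.
by rewrite -[d]mulr1z; apply: (boxlike_segment (i := i.+1)) => //; lia.
Qed.

Lemma quot_step u : B u -> \sum_(i < size rs) z ^+ i * g (u + d *+ i) = g u + z * q u.
Proof.
move=> Bu; have gz i : (size rs <= i)%N -> g (u + d *+ i) = 0.
  by move=> si; apply: contraNeq (leaves_box Bu si) => /gB.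
have s0 : (0 < size rs)%N by case: (rs) (Brs Bu).
rewrite /q /quot Bu; case: (size rs) s0 gz => // m _ gz.
rewrite big_ord_recl [in RHS]big_ord_recr /= (gz m.+1) // mulr0 addr0; congr (_ + _).
  by rewrite expr0 mul1r; congr g; rewrite ?addr0.
by rewrite ?addr0 big_distrr /=; apply: eq_bigr => i _; rewrite mulrA exprS.
Qed.

(** If [u - d] is in the box, the geometric sum defining [q (u - d)] starts at [u] and equals
    [g u + z * q u]. So the remainder lives where lines of direction [d] enter the box. *)
Lemma remainder_support u : r u != 0 -> B u && ~~ B (u - d).
Proof.
have qB v : ~~ shrink d B v -> q v = 0 by move=> nB; apply: contraNeq nB => /quot_support.
rewrite /r; case Bu: (B u); last first.
  have -> : g u = 0 by apply: contraFeq Bu => /gB.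
  by rewrite (qB u) ?(qB (u - d)) /shrink ?subrK ?Bu ?andbF // mulr0 subr0 addr0 eqxx.
case Bd: (B (u - d)) => // /eqP[]; rewrite addrAC -quot_step // /q /quot Bd /=.
apply/eqP; rewrite subr_eq0; apply/eqP/eq_bigr => i _; congr (_ * g _).
by rewrite mulrS addrA subrK.
Qed.

Lemma conv_quot w t : conv rs g w t = conv rs q (twist (d, z) w) t + conv rs r w t.
Proof.
have -> : conv rs q (twist (d, z) w) t =
    \sum_(u <- rs) q (u - d) * w (t + u) - \sum_(u <- rs) z * q u * w (t + u).
  rewrite (@big_support _ _ rs [seq u + d | u <- rs] (fun u => q (u - d) * w (t + u))) //.
  - rewrite big_map -sumrB; apply: eq_bigr => u _; rewrite /twist /= addrK.
    by rewrite [t + (u + d)]addrA; ring.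
  - by rewrite map_inj_uniq // => a b /addIr.
  move=> u nz; have : q (u - d) != 0 by apply: contra_neq nz => ->; rewrite mul0r.
  move/quot_support; rewrite /shrink subrK => /andP[/Brs h1 /Brs ->].
  by apply/esym/mapP; exists (u - d); rewrite ?subrK.
rewrite -sumrB -big_split /=; apply: eq_bigr => u _; rewrite /r; ring.
Qed.

(** A line of direction [d] enters a box only once; [d] being primitive, equal values of [cross d]
    mean points differing by a multiple of [d]. *)
Lemma remainder_lines u u' : coprimez d.1 d.2 -> r u != 0 -> r u' != 0 ->
  cross d u = cross d u' -> u = u'.
Proof.
move=> cd /remainder_support/andP[Bu nBu] /remainder_support/andP[Bu' nBu'] e.
have [v vd dec] := unimodular_complement cd.
set m := cross u' v - cross u v.
have e2 : u' = u + d *~ m by rewrite [u in RHS]dec [LHS]dec -addrA -mulrzDr e; congr (_ + _ *~ _); rewrite /m; lia.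
case: (ltgtP m 0) => m0; last by rewrite e2 m0 mulr0z addr0.
  case/negP: nBu; have -> : u - d = u' + d *~ (- m - 1).
    rewrite e2 -addrA -mulrzDr -[in LHS](mulr1z d) -mulrNz; congr (_ + _ *~ _); lia.
  apply: (boxlike_segment (i := - m)) => //; last by lia.
  by rewrite e2 -addrA -mulrzDr addrN mulr0z addr0.
case/negP: nBu'; have -> : u' - d = u + d *~ (m - 1) by rewrite mulrzDr mulrNz mulr1z addrA -e2.
by apply: (boxlike_segment (i := m)) => //; rewrite -?e2 //; lia.
Qed.

End Quotient.

(** The remainder sends [twists P w] to a doubly periodic function, so a nonzero one would make
    [twists P w] doubly periodic, against minimality. Hence every division is exact, and a zero
    final quotient forces [g = 0]. *)
Lemma division_zero (rs : seq vec) P : uniq rs -> forall B g w, boxlike B -> (forall u, B u -> u \in rs) ->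
  (forall u, g u != 0 -> B u) -> fin_valued w -> all admissible P -> minimal_twists P w ->
  doubly_per (conv rs g w) -> (forall u, core B P u -> quots (size rs) B P g u = 0) -> forall u, g u = 0.
Proof.
move=> Urs; elim: P => [|[d z] P IH] B g w bB Brs gB fw adm [dpw minw] dpc q0 u.
  by apply: contraTeq isT => /[dup] nz /gB /q0 /= e; rewrite e eqxx in nz.
move: adm => /= /andP[/andP[/= cd z0] adm].
have d0 : d != 0 by apply/eqP => e; move: cd; rewrite e.
pose q := quot (size rs) B (d, z) g.
pose r u := g u - q (u - d) + z * q u.
have ndp : ~ doubly_per (twists P w) by apply: (minw [::] (d, z) P).
have r0 v : r v = 0.
  apply/eqP; apply: contra_notT ndp => nz.
  have fh := fin_valued_twists P fw.
  have dph : doubly_per (twist (d, z) (twists P w)) by rewrite -twists_twist.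
  have [Bv _] := andP (remainder_support Urs bB Brs d0 gB nz).
  apply: (line_recurrence (rs := rs) (a := r) cd z0 fh dph Urs (Brs _ Bv) nz).
    by move=> a b _ _; apply: remainder_lines.
  have dp1 : doubly_per (conv rs g (twists P w)) by rewrite -twists_conv; apply: doubly_per_twists.
  have dp2 : doubly_per (conv rs q (twist (d, z) (twists P w))).
    apply: doubly_per_sum => a; apply: doubly_per_scale; exact: doubly_per_shift.
  apply: eq_ind (doubly_per_add dp1 (doubly_per_opp dp2)) _ _.
  by apply/funext => t; rewrite (@conv_quot rs B d z) // addrAC subrr add0r.
have qz : forall u, q u = 0.
  apply: (IH (shrink d B) q (twist (d, z) w)) => //.
  - exact: boxlike_shrink.
  - by move=> a /andP[/Brs].
  - by move=> a; apply: quot_support.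
  - exact: fin_valued_twist.
  - split=> // P1 y P2 e; have := minw ((d, z) :: P1) y P2; rewrite e; exact.
  - apply: eq_ind dpc _ _; apply/funext => t; rewrite (@conv_quot rs B d z) //.
    rewrite [X in _ + X]big1 ?addr0 // => a _; by rewrite -/q [X in X * _]r0 mul0r.
by have := r0 u; rewrite /r !qz mulr0 subr0 addr0.
Qed.

End Division.

(** * Action of bivariate polynomials *)

Section Action.
Variable R : comNzRingType.
Implicit Types (w : vec -> R) (t u v : vec).

(** A unital ring action on functions on the plane that commutes with translations. *)
Definition is_action (A : comNzRingType) (al : A -> (vec -> R) -> vec -> R) :=
  [/\ forall a b w t, al (a + b) w t = al a w t + al b w t,
      forall a b w, al (a * b) w = al a (al b w),
      forall a w w' t, al a (fun s => w s + w' s) t = al a w t + al a w' t,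
      forall a w u, al a (fun s => w (s + u)) = (fun s => al a w (s + u)) &
      forall w, al 1 w = w].

(** Extends an action of [A] to polynomials over [A], the variable acting as translation by [v]. *)
Definition lift_action (A : comNzRingType) (al : A -> (vec -> R) -> vec -> R) v (P : {poly A}) w t :=
  \sum_(j < size P) al P`_j w (t + v *+ j).

Section Lift.
Variables (A : comNzRingType) (al : A -> (vec -> R) -> vec -> R) (v : vec).
Hypothesis al_action : is_action al.
Let lact := lift_action al v.

Lemma action0 w t : al 0 w t = 0.
Proof. by have [D _ _ _ _] := al_action; apply: (addrI (al 0 w t)); rewrite -D !addr0. Qed.

Lemma action_sum (I : Type) (r : seq I) a (f : I -> vec -> R) t :
  al a (fun s => \sum_(i <- r) f i s) t = \sum_(i <- r) al a (f i) t.
Proof.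
have [_ _ D _ _] := al_action; have z : al a (fun=> 0) t = 0.
  apply: (addrI (al a (fun=> 0) t)); by rewrite -D !addr0.
elim: r => [|i r IH]; first by rewrite big_nil -[RHS]z; congr (al a _ t); apply/funext => s; rewrite big_nil.
by rewrite big_cons -IH -D; congr (al a _ t); apply/funext => s; rewrite big_cons.
Qed.

Lemma lift_action_widen n (P : {poly A}) w t : (size P <= n)%N -> lact P w t = \sum_(j < n) al P`_j w (t + v *+ j).
Proof.
move=> le; rewrite /lact /lift_action (big_ord_widen _ (fun j => al P`_j w (t + v *+ j)) le) big_mkcond.
apply: eq_bigr => j _; case: ltnP => // h; by rewrite nth_default // action0.
Qed.

Lemma lift_actionD P Q w t : lact (P + Q) w t = lact P w t + lact Q w t.
Proof.
have [D _ _ _ _] := al_action.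
pose n := (maxn (size P) (size Q)); rewrite !(lift_action_widen (n := n)) ?leq_maxl ?leq_maxr ?size_polyD //.
by rewrite -big_split; apply: eq_bigr => j _; rewrite coefD D.
Qed.

Lemma lift_actionMX P w t : lact (P * 'X) w t = lact P w (t + v).
Proof.
rewrite (lift_action_widen (n := (size P).+1)); last by rewrite (leq_trans (size_polyMleq _ _)) // size_polyX addn2.
rewrite big_ord_recl coefMX /= action0 add0r; apply: eq_bigr => j _.
by rewrite coefMX /= -addrA -mulrS.
Qed.

Lemma lift_actionC c w t : lact c%:P w t = al c w t.
Proof. by rewrite (lift_action_widen (n := 1)) ?size_polyC_leq1 // big_ord1 coefC mulr0n addr0. Qed.

Lemma lift_actionCM c Q w t : lact (c%:P * Q) w t = al c (lact Q w) t.
Proof.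
have [_ M _ S _] := al_action.
rewrite (lift_action_widen (n := size Q)) ?mul_polyC ?size_scale_leq // /lact /lift_action action_sum.
by apply: eq_bigr => j _; rewrite coefZ M S.
Qed.

Lemma lift_is_action : is_action lact.
Proof.
have [D M Dw S U] := al_action; split.
- exact: lift_actionD.
- move=> P Q w; apply/funext => t; elim/poly_ind: P t => [|P c IH] t.
    by rewrite mul0r /lact /lift_action size_poly0 !big_ord0.
  by rewrite mulrDl -mulrA [_ * Q]mulrC mulrA !lift_actionD !lift_actionMX lift_actionC lift_actionCM IH.
- by move=> P w w' t; rewrite -big_split; apply: eq_bigr => j _; rewrite Dw.
- move=> P w u; apply/funext => t; apply: eq_bigr => j _; by rewrite S addrAC.
- by move=> w; apply/funext => t; rewrite -[1]/(1%:P) lift_actionC U.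
Qed.

Lemma lift_actionXn c n w t : lact (c%:P * 'X^n) w t = al c w (t + v *+ n).
Proof.
elim: n t => [|n IH] t; first by rewrite expr0 mulr1 mulr0n addr0 lift_actionC.
by rewrite exprSr mulrA lift_actionMX IH -addrA -mulrS.
Qed.

End Lift.

Definition scalar_action (a : R) w t := a * w t.

Lemma scalar_is_action : is_action scalar_action.
Proof.
split; rewrite /scalar_action => *; rewrite ?mulrDl ?mulrDr //.
- by apply/funext => t; rewrite mulrA.
- by apply/funext => t; rewrite mul1r.
Qed.

(** The inner variable moves the first coordinate and the outer one the second, so the coefficient
    of X^i Y^j is the [i]-th one inside the [j]-th. *)
Definition pact : {poly {poly R}} -> (vec -> R) -> vec -> R :=
  lift_action (lift_action scalar_action (1, 0)) (0, 1).

Lemma pact_is_action : is_action pact.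
Proof. exact/lift_is_action/lift_is_action/scalar_is_action. Qed.

Definition monom (a : R) (i j : nat) : {poly {poly R}} := (a%:P * 'X^i)%:P * 'X^j.

Lemma pact_monom a i j w t : pact (monom a i j) w t = a * w (t + (i%:Z, j%:Z)).
Proof.
rewrite /pact /monom lift_actionXn; last exact/lift_is_action/scalar_is_action.
rewrite lift_actionXn; last exact/scalar_is_action.
rewrite /scalar_action; congr (_ * w _); rewrite -addrA; congr (_ + _).
by rewrite !vec_muln vec_add; congr (_, _) => /=; lia.
Qed.

Lemma pactD P Q w t : pact (P + Q) w t = pact P w t + pact Q w t.
Proof. by have [D _ _ _ _] := pact_is_action. Qed.

Lemma pactM P Q w : pact (P * Q) w = pact P (pact Q w).
Proof. by have [_ M _ _ _] := pact_is_action. Qed.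

Lemma pact0 w t : pact 0 w t = 0.
Proof. exact: (action0 pact_is_action). Qed.

Lemma pact_fun0 P t : pact P (fun=> 0) t = 0.
Proof.
have := action_sum pact_is_action [::] P (fun (_ : unit) (_ : vec) => 0) t.
by rewrite !big_nil.
Qed.

Lemma pact_sum (I : Type) (r : seq I) (Q : I -> {poly {poly R}}) w t :
  pact (\sum_(i <- r) Q i) w t = \sum_(i <- r) pact (Q i) w t.
Proof. by elim: r => [|i r IH]; rewrite ?big_nil ?pact0 // !big_cons pactD IH. Qed.

Lemma poly_sum_widen (A : comNzRingType) (p : {poly A}) n : (size p <= n)%N ->
  p = \sum_(i < n) (p`_i)%:P * 'X^i.
Proof.
move=> le; apply/polyP => k; rewrite coef_sum.
under eq_bigr do rewrite coefCM coefXn.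
case: (ltnP k n) => h; last first.
  rewrite nth_default ?(leq_trans le) // big1 // => i _.
  by rewrite gtn_eqF ?mulr0 // (leq_trans (ltn_ord i)).
rewrite (bigD1 (Ordinal h)) //= eqxx mulr1 big1 ?addr0 // => i ne.
by rewrite eq_sym -val_eqE /= in ne; rewrite (negPf ne) mulr0.
Qed.

Lemma poly_monoms (P : {poly {poly R}}) : exists n,
  P = \sum_(j < n) \sum_(i < n) monom P`_j`_i i j /\
  forall i j, P`_j`_i != 0 -> (i < n)%N && (j < n)%N.
Proof.
pose m := (\max_(j < size P) size (P`_j)%R)%N; pose n := maxn (size P) m.
have sz j : (size (P`_j)%R <= n)%N.
  case: (ltnP j (size P)) => h; last by rewrite nth_default // size_poly0.
  by rewrite (leq_trans _ (leq_maxr _ _)) // (leq_bigmax (Ordinal h)).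
have szP : (size P <= n)%N by exact: leq_maxl.
exists n; split; last first.
  move=> i j; apply: contraR; rewrite negb_and -!leqNgt => /orP[h|h].
    by rewrite nth_default // (leq_trans (sz j)).
  by rewrite [P`_j]nth_default ?coef0 // (leq_trans szP).
rewrite {1}(poly_sum_widen szP); apply: eq_bigr => j _.
rewrite {1}(poly_sum_widen (sz j)) raddf_sum mulr_suml; exact: eq_bigr.
Qed.

End Action.

(** * Products without annihilators *)

Section Norm.
Variable F : fieldType.

Definition dilate (a b : F) (P : {poly {poly F}}) : {poly {poly F}} :=
  map_poly (comp_poly (a *: 'X)) P \Po (b%:P *: 'X).

Lemma coef_comp_scaleX (A : comNzRingType) (c : A) (p : {poly A}) i : (p \Po (c *: 'X))`_i = p`_i * c ^+ i.
Proof.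
have -> : p \Po (c *: 'X) = \poly_(j < size p) (p`_j * c ^+ j).
  rewrite poly_def comp_polyE; apply: eq_bigr => j _.
  by rewrite exprZn scalerA.
by rewrite coef_poly; case: ltnP => // h; rewrite nth_default // mul0r.
Qed.

Lemma coef_dilate a b P i j : (dilate a b P)`_j`_i = P`_j`_i * a ^+ i * b ^+ j.
Proof.
by rewrite /dilate coef_comp_scaleX -rmorphXn /= mulrC mul_polyC coefZ coef_map /= coef_comp_scaleX mulrC.
Qed.

Lemma dilate_prod (I : Type) (r : seq I) a b (Q : I -> {poly {poly F}}) :
  dilate a b (\prod_(i <- r) Q i) = \prod_(i <- r) dilate a b (Q i).
Proof. by rewrite /dilate !rmorph_prod. Qed.

Lemma dilate_dilate a b a' b' P : dilate a b (dilate a' b' P) = dilate (a * a') (b * b') P.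
Proof. apply/polyP => j; apply/polyP => i; rewrite !coef_dilate !exprMn; ring. Qed.

Lemma dilate1 P : dilate 1 1 P = P.
Proof. by apply/polyP => j; apply/polyP => i; rewrite coef_dilate !expr1n !mulr1. Qed.

Lemma dilate_neq0 a b P : a != 0 -> b != 0 -> P != 0 -> dilate a b P != 0.
Proof.
move=> a0 b0; apply: contra_neq => e.
have -> : P = dilate a^-1 b^-1 (dilate a b P) by rewrite dilate_dilate !mulVf // dilate1.
rewrite e; by apply/polyP => j; apply/polyP => i; rewrite coef_dilate !coef0 !mul0r.
Qed.

Lemma prod_shift_cycle (A : comNzRingType) M (f : nat -> A) : f M = f 0%N ->
  \prod_(i < M) f i.+1 = \prod_(i < M) f i.
Proof. by case: M => [|M] e; rewrite ?big_ord0 // big_ord_recr big_ord_recl /= e mulrC. Qed.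

(* The multiple is the norm of [P], the product of its dilates by [M]-th roots of unity. *)
Lemma exists_multiple_in_powers (M : nat) (w : F) (P : {poly {poly F}}) :
  M.-primitive_root w -> P != 0 ->
  exists2 Q : {poly {poly F}}, P * Q != 0 &
    forall i j, (P * Q)`_j`_i != 0 -> (M %| i)%N && (M %| j)%N.
Proof.
move=> prw P0; have M0 := prim_order_gt0 prw; have wM := prim_expr_order prw.
have w0 : w != 0 by apply: contra_eq_neq wM => ->; rewrite expr0n eqn0Ngt M0 eq_sym oner_eq0.
pose N := \prod_(a < M) \prod_(b < M) dilate (w ^+ a) (w ^+ b) P.
have [Q NQ] : exists Q, N = P * Q.
  rewrite /N; case: (M) M0 => // m _; rewrite big_ord_recl big_ord_recl /= !expr0 dilate1.
  by rewrite -mulrA; eexists.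
(* Multiplying X by [w] permutes the factors of the norm cyclically; below the same for Y. *)
have NX : dilate w 1 N = N.
  rewrite /N dilate_prod -[RHS](@prod_shift_cycle _ M (fun a => \prod_(b < M) dilate (w ^+ a) (w ^+ b) P)) ?wM ?expr0 //.
  apply: eq_bigr => a _; rewrite dilate_prod; apply: eq_bigr => b _.
  by rewrite dilate_dilate exprS mul1r.
have NY : dilate 1 w N = N.
  rewrite /N dilate_prod; apply: eq_bigr => a _; rewrite dilate_prod.
  rewrite -[RHS](@prod_shift_cycle _ M (fun b => dilate (w ^+ a) (w ^+ b) P)) ?wM ?expr0 //.
  by apply: eq_bigr => b _; rewrite dilate_dilate exprS mul1r.
(* Invariance multiplies the coefficient at exponent [k] by [w ^+ k], so it can be nonzero only if
   [M] divides [k]. *)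
have coefN (c : F) k : c != 0 -> c * w ^+ k = c -> (M %| k)%N.
  move=> c0 e; rewrite (prim_order_dvd prw) -(inj_eq (mulfI c0)) e mulr1 eqxx //.
exists Q; rewrite -NQ.
  by apply/prodf_neq0 => a _; apply/prodf_neq0 => b _; rewrite dilate_neq0 // expf_neq0.
move=> i j nz; apply/andP; split; apply: (coefN _ _ nz).
  by rewrite -[in RHS]NX coef_dilate expr1n mulr1.
by rewrite -[in RHS]NY coef_dilate expr1n mulr1.
Qed.

End Norm.

(** With [p / D] and [q / D] in [0, 1], [v] lies in the hull of the differences of the intervals
    [0, y] and [0, x], and every integer in that hull is a difference of integer points. *)
Lemma align_coordinate (x y v p q D : int) : 0 < D -> 0 <= p <= D -> 0 <= q <= D ->
  D * v = q * y - p * x -> exists a b : int, [/\ between 0 x a, between 0 y b & b - a = v].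
Proof.
move=> D0 /andP[p0 pD] /andP[q0 qD] e.
have hx : between 0 (D * x) (p * x).
  by rewrite /between; have [x0|x0] := leP 0 x; apply/orP; [left|right]; apply/andP; split; nia.
have hy : between 0 (D * y) (q * y).
  by rewrite /between; have [y0|y0] := leP 0 y; apply/orP; [left|right]; apply/andP; split; nia.
move: hx hy; rewrite /between.
have [x0|x0] := leP 0 x; have [y0|y0] := leP 0 y => hx hy.
- have h1 : - x <= v <= y by apply/andP; split; nia.
  by case: (leP 0 v) => v0; [exists 0, v|exists (- v), 0]; split; lia.
- have h1 : y - x <= v <= 0 by apply/andP; split; nia.
  by case: (leP y v) => v0; [exists 0, v|exists (y - v), y]; split; lia.
- have h1 : 0 <= v <= y - x by apply/andP; split; nia.
  by case: (leP v y) => v0; [exists 0, v|exists (y - v), y]; split; lia.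
- have h1 : y <= v <= - x by apply/andP; split; nia.
  by case: (leP 0 v) => v0; [exists (- v), 0|exists 0, v]; split; lia.
Qed.

(* The bounding boxes of the segments [0, d] and [0, e] have enough room to realize every class of Z^2
   modulo d and e as a difference, because their difference set contains the parallelogram spanned by -d and e. *)
Lemma align (d e del : vec) : cross d e != 0 -> exists m m' s s',
  [/\ between 0 d.1 s.1 /\ between 0 d.2 s.2, between 0 e.1 s'.1 /\ between 0 e.2 s'.2
    & s' - s = del + e *~ m' - d *~ m].
Proof.
move=> D0.
have main D m m' p q : 0 < D -> 0 <= p <= D -> 0 <= q <= D ->
   D * (del.1 + e.1 * m' - d.1 * m) = q * e.1 - p * d.1 ->
   D * (del.2 + e.2 * m' - d.2 * m) = q * e.2 - p * d.2 ->
   exists m m' s s',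
    [/\ between 0 d.1 s.1 /\ between 0 d.2 s.2, between 0 e.1 s'.1 /\ between 0 e.2 s'.2
    & s' - s = del + e *~ m' - d *~ m].
  move=> Dp hp hq e1 e2.
  have [a [b [ha hb hab]]] := align_coordinate Dp hp hq e1.
  have [a' [b' [ha' hb' hab']]] := align_coordinate Dp hp hq e2.
  exists m, m', (a, a'), (b, b'); split=> //=.
  rewrite !vec_mulz; apply/eqP; rewrite xpair_eqE /=; apply/andP; split; apply/eqP; assumption.
(* By Cramer, [del] has coordinates [A / D] and [B / D] in the basis [d], [e]; [m] and [m'] remove
   their integer parts. *)
pose A := del.1 * e.2 - del.2 * e.1; pose B := d.1 * del.2 - d.2 * del.1.
pose D := cross d e.
have [D1|D1] := ltP 0 D.
  pose m := - ((- A) %/ D)%Z; pose m' := - (B %/ D)%Z.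
  have eA := divz_eq (- A) D; have eB := divz_eq B D.
  have hA : 0 <= ((- A) %% D)%Z < D by rewrite modz_ge0 ?ltz_pmod ?gt_eqF.
  have hB : 0 <= (B %% D)%Z < D by rewrite modz_ge0 ?ltz_pmod ?gt_eqF.
  apply: (main D m m' ((- A) %% D)%Z (B %% D)%Z) => //; try lia.
    have -> : ((- A) %% D)%Z = - A + m * D by rewrite /m; lia.
    have -> : (B %% D)%Z = B + m' * D by rewrite /m'; lia.
    by rewrite /A /B /D /cross; ring.
  have -> : ((- A) %% D)%Z = - A + m * D by rewrite /m; lia.
  have -> : (B %% D)%Z = B + m' * D by rewrite /m'; lia.
  by rewrite /A /B /D /cross; ring.
have D2 : 0 < - D by move: D0; rewrite -/D; lia.
pose m := - (A %/ (- D))%Z; pose m' := - ((- B) %/ (- D))%Z.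
have eA := divz_eq A (- D); have eB := divz_eq (- B) (- D).
have hA : 0 <= (A %% (- D))%Z < - D by rewrite modz_ge0 ?ltz_pmod ?gt_eqF.
have hB : 0 <= ((- B) %% (- D))%Z < - D by rewrite modz_ge0 ?ltz_pmod ?gt_eqF.
apply: (main (- D) m m' (A %% (- D))%Z ((- B) %% (- D))%Z) => //; try lia.
  have -> : (A %% (- D))%Z = A - m * D by rewrite /m; lia.
  have -> : ((- B) %% (- D))%Z = - B - m' * D by rewrite /m'; lia.
  by rewrite /A /B /D /cross; ring.
have -> : (A %% (- D))%Z = A - m * D by rewrite /m; lia.
have -> : ((- B) %% (- D))%Z = - B - m' * D by rewrite /m'; lia.
by rewrite /A /B /D /cross; ring.
Qed.

Lemma vec_regroup (t s d e : vec) (a b a' b' N : int) :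
  t + d *~ (a * N) + e *~ (b * N) + (d *~ (a' * N) + e *~ (b' * N)) + s =
  t + s + e *~ ((b + b') * N) + d *~ ((a + a') * N).
Proof.
case: t s d e => [t1 t2] [s1 s2] [d1 d2] [e1 e2].
by rewrite !vec_mulz !vec_add /=; congr (_, _); ring.
Qed.

(** * Aperiodic sequences on sublattices and products of two of them *)

Section Aperiodic.
Variable F : fieldType.
Implicit Types (h : vec -> F) (d e t u : vec).

Definition aperiodic_at e (N : nat) h t := forall S : nat, (0 < S)%N ->
  exists j : int, h (t + e *~ ((j + S%:Z) * N%:Z)) != h (t + e *~ (j * N%:Z)).

Lemma sublattice_decomp d e (u : vec) : exists p q : int,
  u *~ `|cross d e|%N = d *~ p + e *~ q /\
  (p = Num.sg (cross d e) * (u.1 * e.2 - u.2 * e.1) /\ q = Num.sg (cross d e) * (u.2 * d.1 - u.1 * d.2)).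
Proof.
do 2!eexists; split; last by split; reflexivity.
have sE : (`|cross d e|%N)%:Z = Num.sg (cross d e) * cross d e by rewrite abszE -normrEsg.
by rewrite !vec_mulz vec_add sE /cross; congr (_, _) => /=; ring.
Qed.

(** If every sequence in direction [e] had a period, finitely many base points would suffice, thanks
    to the period along [d]; the product of their periods would make [h] doubly periodic. *)
Lemma exists_aperiodic d e N h : cross d e != 0 -> (0 < N)%N ->
  per_along d h -> ~ doubly_per h -> exists t, aperiodic_at e N h t.
Proof.
move=> D0 N0 pd; apply: contra_notP => na.
have per t : exists S : nat, (0 < S)%N /\ forall j : int,
    h (t + e *~ ((j + S%:Z) * N%:Z)) = h (t + e *~ (j * N%:Z)).
  apply: contra_notP na => np; exists t => S S0; apply: contra_notP np => nj.
  by exists S; split=> // j; apply: contra_notP nj => /eqP nj; exists j.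
have [S hS] := choice per.
case: (pd) => N1 N10 hd.
(* Vectors with both coordinates divisible by [K] are combinations of [d] and [e] with coefficients
   divisible by [N * N1]. *)
pose K := (N * N1 * `|cross d e|)%N.
have K0 : (0 < K)%N by rewrite /K !muln_gt0 N0 N10 absz_gt0.
pose T := (\prod_(x < K) \prod_(y < K) S ((x : nat)%:Z, (y : nat)%:Z))%N.
have T0 : (0 < T)%N.
  by apply: prodn_gt0 => x; apply: prodn_gt0 => y; case: (hS (x%:Z, y%:Z)).
apply: (per_along_doubly D0 pd); exists (N * T)%N; first by rewrite muln_gt0 N0.
move=> t; pose t' : vec := ((t.1 %% K)%Z, (t.2 %% K)%Z).
have [p' [q' [pq _]]] := sublattice_decomp d e ((t.1 %/ K)%Z, (t.2 %/ K)%Z).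
have tE : t = t' + (d *~ (p' * N%:Z * N1%:Z) + e *~ (q' * N1%:Z * N%:Z)).
  have -> : d *~ (p' * N%:Z * N1%:Z) + e *~ (q' * N1%:Z * N%:Z) = (d *~ p' + e *~ q') *~ (N * N1)%N.
    by rewrite mulrzDl -!mulrzA PoszM; congr (_ *~ _ + _ *~ _); lia.
  rewrite -pq -mulrzA vec_mulz [LHS]surjective_pairing vec_add /=.
  have -> : `|cross d e|%:Z * (N * N1)%N = K%:Z by rewrite /K; lia.
  by rewrite [t.1 in LHS](divz_eq _ K) [t.2 in LHS](divz_eq _ K) ![_ * K%:Z + _]addrC.
have [x xE] : exists x : 'I_K, (x : nat)%:Z = (t.1 %% K)%Z.
  have h1 : 0 <= (t.1 %% K)%Z < K%:Z by rewrite modz_ge0 ?ltz_pmod //; lia.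
  have h2 : (absz (t.1 %% K)%Z < K)%N by lia.
  by exists (Ordinal h2) => /=; lia.
have [y yE] : exists x : 'I_K, (x : nat)%:Z = (t.2 %% K)%Z.
  have h1 : 0 <= (t.2 %% K)%Z < K%:Z by rewrite modz_ge0 ?ltz_pmod //; lia.
  have h2 : (absz (t.2 %% K)%Z < K)%N by lia.
  by exists (Ordinal h2) => /=; lia.
have [q TE] : exists q, T = (q * S t')%N.
  exists ((\prod_(x0 < K | x0 != x) \prod_(y < K) S ((x0 : nat)%:Z, (y : nat)%:Z)) *
     (\prod_(y0 < K | y0 != y) S ((x : nat)%:Z, (y0 : nat)%:Z)))%N.
  rewrite /T (bigD1 x) //= (bigD1 y) //= xE yE -/t'.
  by rewrite mulnC [(S t' * _)%N]mulnC mulnA.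
have iter (k : nat) (j : int) : h (t' + e *~ ((j + (k * S t')%N%:Z) * N%:Z)) = h (t' + e *~ (j * N%:Z)).
  elim: k => [|k IH]; first by rewrite mul0n addr0.
  rewrite -[RHS]IH; have [_ hS'] := hS t'; rewrite -[RHS]hS'; congr (h (_ + _ *~ _)); lia.
have e1 j : h (t' + (d *~ (p' * N%:Z * N1%:Z) + e *~ j)) = h (t' + e *~ j).
  by rewrite [d *~ _ + _]addrC addrA per_along_mulz.
rewrite tE e1 -(iter q (q' * N1%:Z)) -TE -e1; congr h.
by rewrite -!addrA pmulrn -mulrzDr; congr (_ + (_ + _ *~ _)); lia.
Qed.

(** Translation by [d *~ m] multiplies [h] by [z ^ m] up to an error of some period [M]; a period
    [S] at the new point would give the period [S * M] at the old one. *)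
Lemma aperiodic_shift d e z N h t m : (0 < N)%N -> z != 0 -> doubly_per (twist (d, z) h) ->
  aperiodic_at e N h t -> aperiodic_at e N h (t + d *~ m).
Proof.
move=> N0 z0 dp ap S S0; apply: contrapT => np.
have per (j : int) : h (t + d *~ m + e *~ ((j + S%:Z) * N%:Z)) = h (t + d *~ m + e *~ (j * N%:Z)).
  by apply: contra_notP np => /eqP ?; exists j.
have [M M0 hM] := twist_eigen m z0 dp.
have zm : z ^ m != 0 by rewrite expfz_neq0.
have [|j /eqP[]] := ap (S * M)%N; first by rewrite muln_gt0 S0.
apply: (mulfI zm).
have iter (k : nat) i : h (t + d *~ m + e *~ ((i + (k * S)%N%:Z) * N%:Z)) = h (t + d *~ m + e *~ (i * N%:Z)).
  elim: k => [|k IH]; first by rewrite mul0n addr0.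
  by rewrite -[RHS]IH -[RHS]per; congr (h (_ + _ *~ _)); lia.
have eq1 s : z ^ m * h s = h (s + d *~ m) - (h (s + d *~ m) - z ^ m * h s) by ring.
rewrite eq1 [RHS]eq1; congr (_ - _).
  by rewrite ![_ + _ + d *~ m]addrAC mulnC iter.
rewrite -[RHS](doubly_per_mulz hM (S * N)%N%:Z _ e).
have -> : t + e *~ (j * N%:Z) + e *~ ((S * N)%N%:Z * M%:Z) = t + e *~ ((j + (S * M)%N%:Z) * N%:Z); last by [].
by rewrite -addrA -mulrzDr; congr (_ + _ *~ _); lia.
Qed.

(* On a suitable sublattice the product is b(j) * c(i) with b and c aperiodic, and the shifts of an aperiodic
   finite-valued sequence are linearly independent. *)
Lemma product_no_annihilator d e z y h h' : (forall M : nat, (0 < M)%N -> exists w : F, M.-primitive_root w) ->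
  cross d e != 0 -> d != 0 -> e != 0 -> z != 0 -> y != 0 -> fin_valued h -> fin_valued h' ->
  doubly_per (twist (d, z) h) -> doubly_per (twist (e, y) h') -> ~ doubly_per h -> ~ doubly_per h' ->
  exists s s', [/\ between 0 d.1 s.1 /\ between 0 d.2 s.2, between 0 e.1 s'.1 /\ between 0 e.2 s'.2
    & forall P, (forall t, pact P (fun u => h (u + s) * h' (u + s')) t = 0) -> P = 0].
Proof.
move=> roots D0 d0 e0 z0 y0 fh fh' dph dph' nh nh'.
have pd : per_along d h.
  by apply: (twist_per_along (e := d) _ d0 fh (doubly_per_along _ dph) d0); rewrite /cross; lia.
have pe : per_along e h'.
  by apply: (twist_per_along (e := e) _ e0 fh' (doubly_per_along _ dph') e0); rewrite /cross; lia.
have [N1 N10 hd1] := pd; have [N2 N20 he2] := pe.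
pose N := (N1 * N2)%N; have N0 : (0 < N)%N by rewrite muln_gt0 N10.
have hd t : h (t + d *+ N) = h t by rewrite -(per_along_mulz hd1 N2%:Z t) pmulrn; congr (h (_ + _ *~ _)); rewrite /N; lia.
have he t : h' (t + e *+ N) = h' t by rewrite -(per_along_mulz he2 N1%:Z t) pmulrn; congr (h' (_ + _ *~ _)); rewrite /N; lia.
have [t1 ap1] := exists_aperiodic D0 N0 pd nh.
have [|t2 ap2] := @exists_aperiodic e d N h' _ N0 pe nh'; first by move: D0; rewrite /cross; lia.
have [m [m' [s [s' [hs hs' ss]]]]] := align (t2 - t1) D0.
exists s, s'; split=> // P annP; apply/eqP; apply: contraT => P0.
(* From this one base point, [s] leads to an aperiodic sequence of [h] and [s'] to one of [h']. *)
pose t0 := t1 + d *~ m - s.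
have t0E : t0 + s' = t2 + e *~ m'.
  have -> : t0 + s' = (s' - s) + (t1 + d *~ m) by rewrite /t0 -addrA addrC [- s + s']addrC.
  by rewrite ss [t1 + _]addrC addrA subrK addrAC subrK.
have apb : aperiodic_at e N h (t0 + s) by rewrite /t0 subrK; apply: aperiodic_shift dph ap1.
have apc : aperiodic_at d N h' (t0 + s') by rewrite t0E; apply: aperiodic_shift dph' ap2.
pose b (j : int) := h (t0 + s + e *~ (j * N%:Z)).
pose c (i : int) := h' (t0 + s' + d *~ (i * N%:Z)).
(* Exponents divisible by [K] translate by combinations of [d *+ N] and [e *+ N]; the first leaves
   [h] fixed, the second [h']. *)
pose K := (N * `|cross d e|)%N.
have K0 : (0 < K)%N by rewrite muln_gt0 N0 absz_gt0.
have [w prw] := roots K K0.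
have [Q nz supp] := exists_multiple_in_powers prw P0.
have annH t : pact (P * Q) (fun u => h (u + s) * h' (u + s')) t = 0.
  rewrite mulrC pactM (_ : pact P _ = fun=> 0) ?pact_fun0 //.
  by apply/funext => v; apply: annP.
have [n [HE Hn]] := poly_monoms (P * Q).
pose cf (k : 'I_n * 'I_n) := (P * Q)`_(k.1)`_(k.2).
pose o1 (k : 'I_n * 'I_n) := Num.sg (cross d e) * ((k.2 %/ K)%N%:Z * e.2 - (k.1 %/ K)%N%:Z * e.1).
pose o2 (k : 'I_n * 'I_n) := Num.sg (cross d e) * ((k.1 %/ K)%N%:Z * d.1 - (k.2 %/ K)%N%:Z * d.2).
have vecE k : cf k != 0 -> ((k.2 : nat)%:Z, (k.1 : nat)%:Z) = d *~ (o1 k * N%:Z) + e *~ (o2 k * N%:Z).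
  move=> /supp /andP[d2 d1].
  have [p [q [pq [pE qE]]]] := sublattice_decomp d e ((k.2 %/ K)%N%:Z, (k.1 %/ K)%N%:Z).
  have -> : o1 k = p by rewrite pE.
  have -> : o2 k = q by rewrite qE.
  rewrite !mulrzA -mulrzDl -pq -mulrzA vec_mulz /=.
  have divE x : (K %| x)%N -> x%:Z = (x %/ K)%N%:Z * ((absz (cross d e))%:Z * N%:Z).
    by move=> /divnK {1}<-; rewrite PoszM {2}/K PoszM; congr (_ * _); rewrite mulrC.
  by congr (_, _); apply: divE.
have rel i j : \sum_k (cf k * b (j + o2 k)) * c (i + o1 k) = 0.
  rewrite -[RHS](annH (t0 + d *~ (i * N%:Z) + e *~ (j * N%:Z))) HE pact_sum.
  under [RHS]eq_bigr do rewrite pact_sum.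
  rewrite pair_big /=; apply: eq_bigr => k _; rewrite pact_monom.
  have [cz|cnz] := eqVneq (cf k) 0; first by rewrite /cf in cz; rewrite /cf cz !mul0r.
  rewrite -/(cf k) -mulrA (vecE k cnz); congr (_ * _); congr (_ * _).
    rewrite /b -[LHS](per_along_mulz hd (i + o1 k)); congr h.
    by rewrite vec_regroup.
  rewrite /c -[LHS](per_along_mulz he (j + o2 k)); congr h'.
  by rewrite vec_regroup addrAC.
have [S hS] := fh; have [S' hS'] := fh'.
(* Independence is used twice: first for the shifts of [c], with values of [b] inside the
   coefficients, then for the shifts of [b]. *)
have rel2 z1 j : \sum_(k | o1 k == z1) cf k * b (j + o2 k) = 0.
  by apply: (shifts_independent (b := c) (s := S')) (rel^~ j) z1 => [i|] //; rewrite /c.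
have rel3 z1 z2 : \sum_(k | (o1 k == z1) && (o2 k == z2)) cf k = 0.
  rewrite -big_filter_cond; apply: (shifts_independent (b := b) (s := S)) => [j||j] //; first by rewrite /b.
  by rewrite big_filter; apply: rel2.
suff : P * Q = 0 by move=> e1; rewrite e1 eqxx in nz.
apply/polyP => j; apply/polyP => i; rewrite !coef0; apply/eqP; apply: contraT => ci.
have /andP[ni nj] := Hn _ _ ci.
pose k0 := (Ordinal nj, Ordinal ni).
(* The offsets [o1] and [o2] determine a monomial with nonzero coefficient, so the sum has a single
   nonzero term at most. *)
have := rel3 (o1 k0) (o2 k0); rewrite (bigD1 k0) /= ?eqxx // big1 ?addr0; last first.
  move=> k /andP[/andP[/eqP e1 /eqP e2] ne]; apply/eqP; apply: contraT => ck.
  have := vecE k ck; rewrite e1 e2 -vecE //= => -[f1 f2].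
  by case/eqP: ne; case: k f1 f2 {e1 e2 ck} => k1 k2 /= [f1] [f2]; congr (_, _); apply: val_inj.
by rewrite /cf /= => ci0; rewrite ci0 eqxx in ci.
Qed.

End Aperiodic.

(** * Annihilators of configurations of low complexity *)

(** The matrix of the forms [L j] in the standard basis has a nontrivial kernel. *)
Lemma underdetermined (F : fieldType) (I J : finType) (L : J -> (I -> F) -> F) :
  (forall j a x y, L j (fun i => a * x i + y i) = a * L j x + L j y) -> (#|J| < #|I|)%N ->
  exists2 x : I -> F, exists i, x i != 0 & forall j, L j x = 0.
Proof.
move=> lin lt.
pose M := \matrix_(i < #|I|, j < #|J|) L (enum_val j) (fun k => (k == enum_val i)%:R).
have kM : kermx M != 0.
  by rewrite -mxrank_eq0 mxrank_ker -lt0n subn_gt0 (leq_ltn_trans (rank_leq_col _)).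
pose v := nz_row (kermx M).
have vM : v *m M = 0 by apply/sub_kermxP/nz_row_sub.
have v0 : v != 0 by rewrite nz_row_eq0.
exists (fun i => v 0 (enum_rank i)).
  have [i vi] : exists i, v 0 i != 0.
    by apply/existsP; apply: contraNT v0 => /existsPn h; apply/eqP/rowP => i; rewrite mxE; apply/eqP; have := h i; rewrite negbK.
  by exists (enum_val i); rewrite enum_valK.
move=> j; have Lsum (r : seq I) (x : I -> F) :
    L j (fun k => \sum_(i <- r) x i * (k == i)%:R) = \sum_(i <- r) x i * L j (fun k => (k == i)%:R).
  elim: r => [|i r IH].
    have z : L j (fun=> 0) = 0.
      apply: (addrI (L j (fun=> 0))); rewrite addr0 -{1}[L j _]mul1r -lin.
      by congr L; apply/funext => k; rewrite mulr0 addr0.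
    rewrite big_nil -[RHS]z; congr L; apply/funext => k; exact: big_nil.
  rewrite big_cons -IH -lin; congr L; apply/funext => k; exact: big_cons.
transitivity ((v *m M) 0 (enum_rank j)); last by rewrite vM mxE.
rewrite mxE (reindex enum_rank) /=; last by apply: onW_bij; apply: enum_rank_bij.
transitivity (L j (fun k => \sum_(i : I) v 0 (enum_rank i) * (k == i)%:R)).
  congr L; apply/funext => k; rewrite (bigD1 k) //= eqxx mulr1 big1 ?addr0 // => i ne.
  by rewrite eq_sym (negPf ne) mulr0.
by rewrite Lsum; apply: eq_bigr => i _; rewrite mxE !enum_rankK.
Qed.

Section Delta.
Variable R : comNzRingType.
Implicit Types (w : vec -> R) (t u v : vec).

Definition delta v w t := w (t + v) - w t.

Fixpoint deltas (W : seq vec) w := if W is v :: W' then deltas W' (delta v w) else w.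

Lemma deltas_shift W w u t : deltas W (fun s => w (s + u)) t = deltas W w (t + u).
Proof.
elim: W w t => //= v W IH w t; rewrite -IH; congr (deltas W _ t); apply/funext => s.
by rewrite /delta addrAC.
Qed.

Lemma deltas_scale W w a t : deltas W (fun s => a * w s) t = a * deltas W w t.
Proof.
elim: W w t => //= v W IH w t; rewrite -IH; congr (deltas W _ t); apply/funext => s.
by rewrite /delta mulrBr.
Qed.

(* The difference of the relations for i+1 and i, the latter translated by r times the vector of k, loses the k-th term. *)
Lemma eliminate (K : Type) (e : K -> vec) (r : nat) (s : seq K) k0 (f : K -> vec -> R) :
  (forall (i : nat) t, \sum_(k <- k0 :: s) f k (t + e k *+ (i * r)) = 0) ->
  forall t, deltas [seq (e k0 - e k) *+ r | k <- s] (f k0) t = 0.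
Proof.
elim: s f => [|k s IH] f rel t /=.
  by have := rel 0%N t; rewrite big_seq1 mul0n mulr0n addr0.
pose g k' u := f k' (u + e k' *+ r) - f k' (u + e k *+ r).
have relg (i : nat) u : \sum_(k' <- k0 :: s) g k' (u + e k' *+ (i * r)) = 0.
  have split j v : \sum_(k' <- k0 :: s) f k' (v + e k' *+ (j * r)) = - f k (v + e k *+ (j * r)).
    by apply/eqP; rewrite -addr_eq0 -[X in _ == X](rel j v) !big_cons; apply/eqP; ring.
  have E k' : u + e k' *+ (i * r) + e k' *+ r = u + e k' *+ (i.+1 * r).
    by rewrite -addrA -mulrnDr; congr (_ + _ *+ _); lia.
  transitivity (\sum_(k' <- k0 :: s) f k' (u + e k' *+ (i.+1 * r)) -
      \sum_(k' <- k0 :: s) f k' (u + e k *+ r + e k' *+ (i * r))).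
    by rewrite -sumrB; apply: eq_bigr => k' _; rewrite /g E addrAC.
  by rewrite !split -E addrAC addrC subrr.
have := IH g relg (t - e k *+ r).
have -> : g k0 = fun u => delta ((e k0 - e k) *+ r) (f k0) (u + e k *+ r).
  by apply/funext => u; rewrite /g /delta -addrA -mulrnDl [e k + _]addrC subrK.
by rewrite deltas_shift subrK.
Qed.

End Delta.

(** * Dilating a relation by integers without small prime factors *)

Section Frobenius.
Variables (I : finType) (c : I -> int) (a b : I -> nat) (B : nat).

Let dil (m : nat) (i : I) : vec := ((m * a i)%N%:Z, (m * b i)%N%:Z).

(** Modulo [p], the [p]-th power of an annihilator is its dilate by [p]. The dilated sum is thus
    divisible by [p] but smaller than [p] in absolute value. *)
Lemma frobenius_relation p (w : vec -> int) : prime p -> (B * \sum_i absz (c i) < p)%N ->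
  (forall t, (absz (w t) <= B)%N) -> (forall t, \sum_i c i * w (t + dil 1 i) = 0) ->
  forall t, \sum_i c i * w (t + dil p i) = 0.
Proof.
move=> pp lt wB rel t.
pose P : {poly {poly 'F_p}} := \sum_i monom (c i)%:~R (a i) (b i).
pose w' (s : vec) : 'F_p := (w s)%:~R.
have act0 : pact P w' = fun=> 0.
  apply/funext => s; rewrite /P pact_sum -[RHS]/((0 : int)%:~R) -(rel s) rmorph_sum.
  by apply: eq_bigr => i _; rewrite pact_monom rmorphM /dil !mul1n.
have chp : p \in [pchar {poly {poly 'F_p}}] by rewrite pchar_poly pchar_poly pchar_Fp.
have PpE : P ^+ p = \sum_i monom (c i)%:~R (p * a i) (p * b i).
  rewrite -(pFrobenius_autE chp) rmorph_sum; apply: eq_bigr => i _.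
  rewrite /= pFrobenius_autE /monom exprMn -rmorphXn exprMn -rmorphXn -!exprM.
  rewrite ![(p * _)%N]mulnC; congr ((_%:P * _)%:P * _).
  by have := expf_card ((c i)%:~R : 'F_p); rewrite card_Fp.
have : pact (P ^+ p) w' t = 0.
  have -> : P ^+ p = P ^+ p.-1 * P by rewrite -exprSr prednK ?prime_gt0.
  by rewrite pactM act0 pact_fun0.
rewrite PpE pact_sum.
have -> : \sum_i pact (monom (c i)%:~R (p * a i) (p * b i)) w' t = (\sum_i c i * w (t + dil p i))%:~R.
  by rewrite rmorph_sum; apply: eq_bigr => i _; rewrite pact_monom rmorphM.
set S := \sum_i _ => /eqP; rewrite -(dvdz_pcharf (pchar_Fp pp)) dvdzE /= => dv.
have Sp : (absz S < p)%N.
  apply: leq_ltn_trans lt; rewrite big_distrr /= /S.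
  elim/big_rec2: _ => // i x y _ IH; have := wB (t + dil p i); nia.
by apply/eqP; rewrite -absz_eq0; apply: contraTT dv => S0; rewrite gtnNdvd // lt0n.
Qed.

(** Primes are peeled off [m] one at a time: the relation dilated by [p] is the original relation
    for [w] restricted to a translate of the sublattice of multiples of [p]. *)
Lemma dilated_relation m (w : vec -> int) : (0 < m)%N ->
  (forall p, prime p -> p %| m -> B * \sum_i absz (c i) < p)%N ->
  (forall t, (absz (w t) <= B)%N) -> (forall t, \sum_i c i * w (t + dil 1 i) = 0) ->
  forall t, \sum_i c i * w (t + dil m i) = 0.
Proof.
elim/ltn_ind: m w => m IH w m0 pm wB rel t.
have [m1|m1] := leqP m 1; first by have -> : m = 1%N by lia.
have pp := pdiv_prime m1; have pd := pdiv_dvd m.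
set p := pdiv m in pp pd; have mE := divnK pd.
have p1 := prime_gt1 pp.
have q0 : (0 < m %/ p)%N by rewrite divn_gt0 ?prime_gt0 // dvdn_leq.
have qm : (m %/ p < m)%N by rewrite ltn_Pdiv.
pose w' (s : vec) := w (t + (p%:Z * s.1, p%:Z * s.2)).
have rel' s : \sum_i c i * w' (s + dil 1 i) = 0.
  have := frobenius_relation pp (pm p pp pd) wB rel (t + (p%:Z * s.1, p%:Z * s.2)).
  apply: etrans; apply: eq_bigr => i _; congr (_ * w _).
  by rewrite -addrA vec_add /dil; congr (_ + (_, _)) => /=; lia.
have pm' p' : prime p' -> (p' %| m %/ p)%N -> (B * \sum_i absz (c i) < p')%N.
  by move=> pp' pd'; apply: pm => //; rewrite -mE dvdn_mulr.
have := IH _ qm w' q0 pm' (fun s => wB _) rel' 0.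
apply: etrans; apply: eq_bigr => i _; congr (_ * w _); rewrite add0r.
by congr (_ + (_, _)) => /=; rewrite -[in LHS]mE -PoszM; congr Posz; lia.
Qed.

End Frobenius.

Lemma integer_multiple (I : finType) (x : I -> rat) :
  exists2 D : int, D != 0 & exists y : I -> int, forall i, (y i)%:~R = D%:~R * x i.
Proof.
exists (\prod_i denq (x i)); first by apply/prodf_neq0 => i _; apply: denq_neq0.
exists (fun i => numq (x i) * \prod_(j | j != i) denq (x j)) => i.
rewrite [in RHS](bigD1 i) //= !intrM [RHS]mulrAC; congr (_ * _).
by rewrite numqE mulrC.
Qed.

Lemma coef_monom (R : comNzRingType) (a : R) i j k l :
  (monom a i j)`_l`_k = a * (k == i)%:R * (l == j)%:R.
Proof.
rewrite /monom coefCM coefXn; case: eqP => _; first by rewrite mulr1 coefCM coefXn mulr1.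
by rewrite !mulr0 coef0.
Qed.

Lemma monomX_sub1_neq0 (R : comNzRingType) : monom 1 1 0 + monom (- 1) 0 0 != 0 :> {poly {poly R}}.
Proof.
apply/eqP => /(congr1 (fun P : {poly {poly R}} => P`_0`_1)).
by rewrite coefD coefD !coef_monom !coef0 /= !mulr1 mulr0 addr0 => /eqP; rewrite oner_eq0.
Qed.

Lemma sum_monom_neq0 (R : comNzRingType) (n k : nat) (c : 'I_n * 'I_k -> R) i0 : c i0 != 0 ->
  \sum_i monom (c i) i.1 i.2 != 0.
Proof.
apply: contra_neq => /(congr1 (fun P : {poly {poly R}} => P`_(i0.2)`_(i0.1))).
rewrite coef0 coef0 coef_sum coef_sum (bigD1 i0) //= coef_monom !eqxx !mulr1.
rewrite big1 ?addr0 // => i ne; rewrite coef_monom.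
have [e1|_] := eqVneq (i0.1 : nat) i.1; last by rewrite mulr0 mul0r.
have [e2|_] := eqVneq (i0.2 : nat) i.2; last by rewrite mulr0.
case/eqP: ne; rewrite [i]surjective_pairing [i0]surjective_pairing; congr (_, _); exact/val_inj/esym.
Qed.

Definition grid (n k : nat) (i : 'I_n * 'I_k) : vec := ((i.1 : nat)%:Z, (i.2 : nat)%:Z).

Definition num (A : finType) (a : A) : int := (enum_rank a : nat)%:Z.

Lemma num_inj (A : finType) : injective (@num A).
Proof. by move=> a b [] /val_inj /enum_rank_inj. Qed.

(** * From few patterns to an annihilating product of differences *)

Section LowComplexity.
Variables (A : finType) (eta : vec -> A) (n k : nat).
Hypothesis low : (rect_complexity eta n k <= n * k)%N.

Let pats := [set f : {ffun 'I_n * 'I_k -> A} | `[< exists u : vec, f = rect_pattern eta n k u >]].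

Lemma card_patterns : #|{: {f | f \in pats}}| = rect_complexity eta n k.
Proof. by rewrite card_sig; apply: eq_card => f. Qed.

Lemma rect_pattern_in u : rect_pattern eta n k u \in pats.
Proof. by rewrite inE; apply/asboolP; exists u. Qed.

(** There are [n * k + 1] unknowns, one of them a constant term, and one equation per pattern. The
    factor X - 1 finally kills the constant. *)
Lemma low_complexity_annihilator :
  exists2 f : {poly {poly int}}, f != 0 & forall t, pact f (fun s => num (eta s)) t = 0.
Proof.
pose J := {f | f \in pats}; pose I := option ('I_n * 'I_k).
pose L (p : J) (x : I -> rat) := x None + \sum_i x (Some i) * (num (val p i))%:~R.
have [||x [i0 xi0] xL] := @underdetermined _ I J L.
- move=> p a x y; rewrite /L mulrDr mulr_sumr addrACA -big_split /=; congr (_ + _).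
  by apply: eq_bigr => i _; ring.
- by rewrite card_patterns card_option card_prod !card_ord ltnS.
have [D D0 [y yE]] := integer_multiple x.
have rel u : \sum_i y (Some i) * num (eta (grid i + u)) = - y None.
  apply/eqP; rewrite -addr_eq0 -(intr_eq0 rat) rmorphD rmorph_sum /=.
  have := xL (exist (fun f => f \in pats) _ (rect_pattern_in u)); rewrite /L /= => e.
  apply/eqP; transitivity (D%:~R * L (exist (fun f => f \in pats) _ (rect_pattern_in u)) x).
    rewrite /L mulrDr mulr_sumr addrC; congr (_ + _); first exact: yE.
    by apply: eq_bigr => i _; rewrite rmorphM /= yE ffunE mulrA.
  by rewrite /L /= e mulr0.
(* If only the constant term were nonzero, the relation itself would force it to vanish. *)
have [i yi] : exists i, y (Some i) != 0.
  apply: contrapT => ny; have y0 i : y (Some i) = 0 by apply/eqP; apply: contrapT => /negP ?; apply: ny; exists i.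
  have yN : y None = 0.
    have := rel 0; rewrite big1 => [|i _]; last by rewrite y0 mul0r.
    lia.
  have : y i0 = 0 by case: (i0).
  by apply/eqP; rewrite -(intr_eq0 rat) yE mulf_neq0 // intr_eq0.
pose f0 : {poly {poly int}} := \sum_i monom (y (Some i)) i.1 i.2.
have f0E : pact f0 (fun s => num (eta s)) = fun=> - y None.
  apply/funext => t; rewrite -(rel t) pact_sum; apply: eq_bigr => j _.
  by rewrite pact_monom addrC.
exists ((monom 1 1 0 + monom (- 1) 0 0) * f0); last first.
  by move=> t; rewrite pactM f0E pactD !pact_monom mulN1r mul1r opprK addrC subrr.
rewrite mulf_neq0 ?monomX_sub1_neq0 //; exact: sum_monom_neq0 yi.
Qed.

End LowComplexity.

Lemma annihilated_differences (f : {poly {poly int}}) (w : vec -> int) (B : nat) : f != 0 ->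
  (forall t, (absz (w t) <= B)%N) -> (forall t, pact f w t = 0) ->
  exists2 W : seq vec, forall v, v \in W -> v != 0 & forall t, deltas W w t = 0.
Proof.
move=> f0 wB ann; have [n [fE fn]] := poly_monoms f.
pose c (i : 'I_n * 'I_n) := f`_(i.1)`_(i.2).
pose a (i : 'I_n * 'I_n) := (i.2 : nat); pose b (i : 'I_n * 'I_n) := (i.1 : nat).
have rel t : \sum_i c i * w (t + ((1 * a i)%N%:Z, (1 * b i)%N%:Z)) = 0.
  rewrite -[RHS](ann t) [in RHS]fE pact_sum.
  under [RHS]eq_bigr do rewrite pact_sum.
  by rewrite pair_big /=; apply: eq_bigr => i _; rewrite pact_monom !mul1n.
(* Every prime factor of [1 + i * r] exceeds [Bd], because [r] is divisible by all smaller primes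
   and by [Bd]. *)
pose Bd := (B * \sum_i absz (c i))%N; pose r := (Bd`!)%N.
have r0 : (0 < r)%N by apply: fact_gt0.
have [i0 ci0] : exists i0, c i0 != 0.
  apply: contrapT => nc; case/eqP: f0; apply/polyP => j; apply/polyP => i; rewrite !coef0.
  apply/eqP; apply: contrapT => /negP nz; have /andP[ni nj] := fn _ _ nz.
  by apply: nc; exists (Ordinal nj, Ordinal ni).
pose e i : vec := ((a i)%:Z, (b i)%:Z).
pose s := [seq i <- index_enum _ | i != i0].
exists [seq (e i0 - e i) *+ r | i <- s].
  move=> v /mapP[i]; rewrite mem_filter => /andP[ne _] ->; apply: contra_neq ne.
  rewrite vec_muln => -[/eqP h1 /eqP h2]; move: h1 h2; rewrite !mulf_eq0 /= !(gt_eqF (_ : 0 < r%:Z)) ?orbF //.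
  move=> /eqP h1 /eqP h2; rewrite [i]surjective_pairing [i0]surjective_pairing; congr (_, _); apply: val_inj; rewrite /=.
    by move: h2; rewrite /b; lia.
  by move: h1; rewrite /a; lia.
move=> t.
have := @eliminate _ _ e r s i0 (fun i u => c i * w (u + e i)) _ (t - e i0).
rewrite deltas_scale deltas_shift subrK => /(_ _)/eqP; rewrite mulf_eq0 (negPf ci0) => h; apply/eqP/h => {h} i u.
have pm p : prime p -> (p %| 1 + i * r)%N -> (Bd < p)%N.
  move=> pp dv; rewrite ltnNge; apply/negP => le.
  have pir : (p %| i * r)%N by rewrite dvdn_mull // dvdn_fact // prime_gt0.
  by move: dv pp; rewrite (dvdn_addl _ pir) dvdn1 => /eqP ->.
have := @dilated_relation _ c a b B (1 + i * r) w isT pm wB rel u.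
apply: etrans; rewrite (bigD1 i0) //= big_cons big_filter; congr (_ + _).
  by rewrite vec_muln -addrA vec_add; congr (_ * w (_ + (_, _))) => /=; lia.
by apply: eq_bigr => j _; rewrite vec_muln -addrA vec_add; congr (_ * w (_ + (_, _))) => /=; lia.
Qed.

(** * Splitting differences into factors with primitive direction *)

Lemma primitive_decomp (v : vec) : v != 0 ->
  exists d N, [/\ coprimez d.1 d.2, (0 < N)%N & v = d *+ N].
Proof.
move=> v0; pose g := gcdz v.1 v.2.
have g0 : g != 0.
  by apply: contra_neq v0; rewrite /g => /eqP; rewrite gcdz_eq0 => /andP[/eqP h1 /eqP h2]; rewrite [v]surjective_pairing h1 h2.
have d1 := dvdz_gcdl v.1 v.2; have d2 := dvdz_gcdr v.1 v.2.
exists ((v.1 %/ g)%Z, (v.2 %/ g)%Z), (absz g); split.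
- have [x [y e]] := Bezoutz v.1 v.2; apply/coprimezP; exists (x, y) => /=.
  apply: (mulIf g0); rewrite mul1r mulrDl -!mulrA (divzK d1) (divzK d2); exact: e.
- by rewrite absz_gt0.
rewrite vec_muln /=; have -> : (absz g)%:Z = g by rewrite /g /gcdz.
by rewrite (divzK d1) (divzK d2) -surjective_pairing.
Qed.

Lemma twists_roots (d : vec) (zs : seq algC) w t :
  twists [seq (d, z) | z <- zs] w t =
  lift_action (@scalar_action algC) d (\prod_(z <- zs) ('X - z%:P)) w t.
Proof.
have sa := @scalar_is_action algC; have [_ M _ _ U] := lift_is_action d sa.
elim: zs w t => [|z zs IH] w t; first by rewrite big_nil U.
rewrite /= IH big_cons mulrC M; congr (lift_action _ _ _ _ _); apply/funext => u.
rewrite -[X in _ = lift_action _ _ X _ _]/('X + - z%:P) -polyCN lift_actionD // lift_actionC //.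
by rewrite -['X]mul1r lift_actionMX // -[1]/(1%:P) lift_actionC // /scalar_action mul1r mulNr.
Qed.

(** For [v = d *+ N] with [d] primitive, X^v - 1 is the product of X^d - y over the [N]-th roots of
    unity [y]. *)
Lemma factor_differences (W : seq vec) : (forall v, v \in W -> v != 0) ->
  exists2 P : seq (vec * algC), all (@admissible algC) P & forall w, twists P w = deltas W w.
Proof.
elim: W => [|v W IH] W0; first by exists [::].
have [P admP PE] := IH (fun u h => W0 u (mem_behead (h : u \in behead (v :: W)))).
have [d [N [cd N0 vE]]] := primitive_decomp (W0 v (mem_head _ _)).
have [z prz] := C_prim_root_exists N0.
have z0 : z != 0.
  by apply: contra_eq_neq (prim_expr_order prz) => ->; rewrite expr0n eqn0Ngt N0 eq_sym oner_eq0.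
exists ([seq (d, y) | y <- [seq z ^+ i | i <- index_iota 0 N]] ++ P).
  rewrite all_cat admP andbT; apply/allP => x /mapP[y /mapP[i _ ->] ->].
  by rewrite /admissible /= cd expf_neq0.
move=> w; rewrite twists_cat PE /=; congr (deltas W); apply/funext => t.
rewrite twists_roots big_map (factor_Xn_sub_1 prz).
have sa := @scalar_is_action algC.
rewrite -polyCN lift_actionD // -['X^N]mul1r -[1]/(1%:P) lift_actionXn // lift_actionC //.
by rewrite /scalar_action mul1r mulN1r /delta vE.
Qed.

(** * Counting patterns *)

Section Lists.
Variable F : fieldType.
Implicit Types (w : vec -> F) (P : seq (vec * F)) (B : pred vec).

Lemma twists_perm P Q w : perm_eq P Q -> twists P w = twists Q w.
Proof.
suff comm P1 P2 v : twists P1 (twists P2 v) = twists P2 (twists P1 v).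
  move=> pq; apply: (@catCA_perm_ind _ (fun Q => twists P w = twists Q w) _ P Q pq erefl).
  by move=> s1 s2 s3 ->; rewrite !twists_cat; congr (twists s3); apply: comm.
by elim: P1 v => //= x P1 IH v; rewrite -IH (twists_twist P2).
Qed.

Lemma parallel_twists_periodic (d : vec) P w : d != 0 -> (forall x, x \in P -> cross d x.1 = 0) ->
  all (@admissible F) P -> fin_valued w -> doubly_per (twists P w) -> per_along d w.
Proof.
move=> d0; elim: P w => [|[e z] P IH] w par; first by move=> _ _; apply: doubly_per_along.
move=> /= /andP[/andP[/= ce _] adm] fw dp.
have e0 : e != 0 by apply/eqP => e0; move: ce; rewrite e0.
have de : cross d e = 0 by apply: (par (e, z)); apply: mem_head.
have ed : cross e d = 0 by move: de; rewrite /cross; lia.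
apply: (per_along_parallel ed e0); apply: (twist_per_along (e := d) ed e0 fw _ d0).
apply: IH adm (fin_valued_twist _ fw) dp => x xP; apply: par; exact: mem_behead.
Qed.

Lemma shrinkC d e B : shrink d (shrink e B) = shrink e (shrink d B).
Proof. by apply/funext => t; rewrite /shrink andbACA [t + d + e]addrAC. Qed.

Lemma core_shrink d P B u : core (shrink d B) P u -> core B P u /\ core B P (u + d).
Proof.
elim: P B => [|x P IH] B /=; first by move=> /andP[].
by rewrite shrinkC => /IH.
Qed.

Lemma boxlike_core P B : boxlike B -> boxlike (core B P).
Proof. by elim: P B => //= x P IH B bB; apply/IH/boxlike_shrink. Qed.

Lemma core_sub P B u : core B P u -> B u.
Proof. by elim: P B => //= x P IH B /IH /andP[]. Qed.

(** Leaving out the factor of direction [d] shrinks the bounding box, which frees room for a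
    translation by any [s] in the box of [d]. *)
Lemma core_between d P B u s : boxlike B -> core (shrink d B) P u ->
  between 0 d.1 s.1 -> between 0 d.2 s.2 -> core B P (u + s).
Proof.
move=> bB /core_shrink[c1 c2] h1 h2; apply: (boxlike_core bB c1 c2); move: h1 h2; rewrite /between /=; lia.
Qed.

Lemma exists_minimal_twists w P0 : all (@admissible F) P0 -> doubly_per (twists P0 w) ->
  exists P, [/\ all (@admissible F) P, doubly_per (twists P w) &
    forall Q, all (@admissible F) Q -> doubly_per (twists Q w) -> (size P <= size Q)%N].
Proof.
move=> a0 d0.
pose good m := `[< exists P, [/\ size P = m, all (@admissible F) P & doubly_per (twists P w)] >].
have ex : exists m, good m by exists (size P0); apply/asboolP; exists P0.
have [m /asboolP[P [sz aP dP]] hm] := ex_minnP ex.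
by exists P; split=> // Q aQ dQ; rewrite sz; apply: hm; apply/asboolP; exists Q.
Qed.

End Lists.

Lemma deltas_intr (W : seq vec) (w : vec -> int) t :
  deltas W (fun s => (w s)%:~R : algC) t = (deltas W w t)%:~R.
Proof.
elim: W w => //= v W IH w; rewrite -IH; congr (deltas W _ t); apply/funext => s.
by rewrite /delta rmorphB.
Qed.

Lemma annihilator_intr (f : {poly {poly int}}) (w : vec -> int) : f != 0 -> (forall t, pact f w t = 0) ->
  exists2 g : {poly {poly algC}}, g != 0 & pact g (fun s => (w s)%:~R) = fun=> 0.
Proof.
move=> f0 ann; have [n [fE fn]] := poly_monoms f.
pose c (i : 'I_n * 'I_n) := f`_(i.2)`_(i.1).
have [i0 ci0] : exists i0, c i0 != 0.
  apply: contrapT => nc; case/eqP: f0; apply/polyP => j; apply/polyP => i; rewrite !coef0.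
  apply/eqP; apply: contrapT => /negP nz; have /andP[ni nj] := fn _ _ nz.
  by apply: nc; exists (Ordinal ni, Ordinal nj).
exists (\sum_i monom (c i)%:~R i.1 i.2).
  by apply: (sum_monom_neq0 (i0 := i0)); rewrite intr_eq0.
apply/funext => t; rewrite pact_sum -[RHS]/((0 : int)%:~R) -(ann t) [in RHS]fE pact_sum.
under [in RHS]eq_bigr do rewrite pact_sum.
rewrite exchange_big pair_big /= rmorph_sum; apply: eq_bigr => i _.
by rewrite !pact_monom rmorphM.
Qed.

Definition in_rect (n k : nat) : pred vec := fun u => (0 <= u.1 < n%:Z) && (0 <= u.2 < k%:Z).

Lemma boxlike_rect n k : boxlike (in_rect n k).
Proof.
move=> p q r; rewrite /in_rect /between; move: (p.1) (p.2) (q.1) (q.2) (r.1) (r.2) => *; lia.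
Qed.

Lemma in_rectP n k u : reflect (exists i, u = @grid n k i) (in_rect n k u).
Proof.
apply: (iffP idP) => [/andP[h1 h2]|[i ->]]; last by rewrite /in_rect /= !ltz_nat !ltn_ord.
have a1 : (absz u.1 < n)%N by lia.
have a2 : (absz u.2 < k)%N by lia.
exists (Ordinal a1, Ordinal a2); rewrite [LHS]surjective_pairing /grid /=; congr (_, _); lia.
Qed.

Lemma grid_inj n k : injective (@grid n k).
Proof. by move=> [a b] [c d] [/val_inj -> /val_inj ->]. Qed.

(** * Visible functions and the dimension count *)

Section Nivat.
Variables (A : finType) (eta : vec -> A) (n k : nat).

Let w t : algC := (num (eta t))%:~R.

Definition visible (o : vec -> algC) := forall t u,
  rect_pattern eta n k t = rect_pattern eta n k u -> o t = o u.

Lemma visible_letter u : in_rect n k u -> visible (fun t => w (t + u)).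
Proof.
move=> /in_rectP[i ->] t s /ffunP /(_ i); rewrite !ffunE => e.
by rewrite /w ![_ + grid i]addrC /grid e.
Qed.

Lemma visible_twists P (v : vec -> algC) (B : pred vec) u : (forall u, B u -> visible (fun t => v (t + u))) ->
  core B P u -> visible (fun t => twists P v (t + u)).
Proof.
elim: P v B => [|x P IH] v B vis /=; first exact: vis.
apply: IH => s /andP[Bs Bd] t t' e; rewrite /twist -!addrA (vis _ Bd t t' e); congr (_ - _ * _).
exact: vis.
Qed.

Lemma fin_valued_letters : fin_valued w.
Proof. by exists [seq (num a)%:~R | a <- enum A] => t; apply/mapP; exists (eta t); rewrite ?mem_enum. Qed.

Theorem low_complexity_periodic : (rect_complexity eta n k <= n * k)%N -> periodic eta.
Proof.
move=> low.
have [f f0 annf] := low_complexity_annihilator low.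
have wB t : (absz (num (eta t)) <= #|A|)%N by rewrite /num /= ltnW.
have [W W0 annW] := annihilated_differences f0 wB annf.
have [P0 adm0 PE0] := factor_differences W0.
have dp0 : doubly_per (twists P0 w).
  exists 1%N => // t u; rewrite !PE0 /w !deltas_intr !annW //.
have [P [admP dpP minP]] := exists_minimal_twists adm0 dp0.
have periodicP d : d != 0 -> per_along d w -> periodic eta.
  move=> d0 [N N0 h]; exists (d *+ N); split.
    apply: contra_neq d0; rewrite vec_muln => -[/eqP h1 /eqP h2].
    rewrite [d]surjective_pairing; congr (_, _); apply/eqP; [move: h1|move: h2]; by rewrite mulf_eq0 eqz_nat (gtn_eqF N0) orbF.
  by move=> t; apply: num_inj; apply/eqP; rewrite -(eqr_int algC); apply/eqP/h.
have fw := fin_valued_letters.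
have [[x [y [xP yP xy]]]|npar] := pselect (exists x y, [/\ x \in P, y \in P & cross x.1 y.1 != 0]); last first.
  case: P admP dpP minP npar => [_ dpP _ _|x P admP dpP _ npar].
    by apply: (periodicP (1, 0)) => //; apply: doubly_per_along.
  have x0 : x.1 != 0.
    by move: admP => /= /andP[/andP[cx _] _]; apply/eqP => e; move: cx; rewrite e.
  apply: (periodicP x.1 x0); apply: parallel_twists_periodic x0 _ admP fw dpP => y yP.
  apply/eqP; apply: contra_notT npar => ne; exists x, y; split=> //; exact: mem_head.
exfalso.
have yx : y \in rem x P.
  have : y \in x :: rem x P by rewrite -(perm_mem (perm_to_rem xP)).
  by rewrite inE => /orP[/eqP e|//]; move: xy; rewrite e /cross mulrC subrr eqxx.
pose P3 := rem y (rem x P).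
have permP : perm_eq P [:: x, y & P3].
  by apply: (perm_trans (perm_to_rem xP)); rewrite perm_cons perm_to_rem.
have adm3 : all (@admissible algC) [:: x, y & P3] by rewrite -(perm_all _ permP).
have dp3 : doubly_per (twists [:: x, y & P3] w) by rewrite -(twists_perm w permP).
have min3 : minimal_twists [:: x, y & P3] w.
  split=> // P1 z P2 e dp12.
  have : (size P <= size (P1 ++ P2))%N.
    by apply: minP => //; move: adm3; rewrite e !all_cat /= => /and3P[-> _ ->].
  by rewrite (perm_size permP) e !size_cat /= addnS ltnn.
have /and3P[/andP[cx zx] /andP[cy zy] adm] := adm3.
have x0 : x.1 != 0 by apply/eqP => e; move: cx; rewrite e.
have y0 : y.1 != 0 by apply/eqP => e; move: cy; rewrite e.
pose h := twists (y :: P3) w; pose h' := twists (x :: P3) w.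
have nh : ~ doubly_per h by apply: (proj2 min3 [::] x (y :: P3)).
have nh' : ~ doubly_per h' by apply: (proj2 min3 [:: x] y P3).
have dph : doubly_per (twist (x.1, x.2) h) by rewrite -surjective_pairing /h -twists_twist.
have dph' : doubly_per (twist (y.1, y.2) h').
  by rewrite -surjective_pairing /h' -twists_twist /= twistC.
have [s [s' [[s1 s2] [s1' s2'] noann]]] := product_no_annihilator
  (fun M M0 => let: exist z pz := C_prim_root_exists M0 in ex_intro _ z pz) xy x0 y0 zx zy
  (fin_valued_twists (y :: P3) fw) (fin_valued_twists (x :: P3) fw) dph dph' nh nh'.
pose U t := h (t + s) * h' (t + s').
pose R := in_rect n k; have bR := @boxlike_rect n k.
pose Q := [:: x, y & P3].
(* [h] lacks the factor [x] and [h'] the factor [y], so the shifts by [s] and [s'] keep both within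
   the rectangle. *)
have visU u : core R Q u -> visible (fun t => U (t + u)).
  move=> cu t t' e; rewrite /U -!addrA; congr (_ * _).
    by apply: (visible_twists (B := R)) e; [exact: visible_letter|exact: (core_between (P := y :: P3) bR cu s1 s2)].
  apply: (visible_twists (B := R)) e; first exact: visible_letter.
  have cu' : core (shrink y.1 R) (x :: P3) u by move: cu; rewrite /= shrinkC.
  exact: (core_between (P := x :: P3) bR cu' s1' s2').
pose pats := [set f : {ffun 'I_n * 'I_k -> A} | `[< exists u : vec, f = rect_pattern eta n k u >]].
pose T := ('I_n * 'I_k)%type.
have rep (p : {f | f \in pats}) : exists u, val p = rect_pattern eta n k u.
  by case: p => p pp /=; move: (pp); rewrite inE => /asboolP.
(* A visible function is evaluated on a pattern at a chosen occurrence. *)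
have [rp rpE] := choice rep.
pose rs := [seq @grid n k i | i <- enum {: T}].
have Urs : uniq rs by rewrite map_inj_uniq ?enum_uniq //; apply: grid_inj.
have Rrs u : R u -> u \in rs by move=> /in_rectP[i ->]; apply: map_f; rewrite mem_enum.
pose g (v : option (T + T) -> algC) (u : vec) := \sum_i v (Some (inl i)) * (u == grid i)%:R.
have gE v i : g v (grid i) = v (Some (inl i)).
  rewrite /g (bigD1 i) //= eqxx mulr1 big1 ?addr0 // => j ne.
  by rewrite (inj_eq (@grid_inj n k)) eq_sym (negPf ne) mulr0.
pose L (j : {f | f \in pats} + T) (v : option (T + T) -> algC) := match j with
  | inl p => v None + (\sum_i v (Some (inl i)) * (num (val p i))%:~R +
      \sum_i v (Some (inr i)) * (if core R Q (grid i) then U (rp p + grid i) else 0))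
  | inr i => if core R Q (grid i) then quots (size rs) R Q (g v) (grid i) else v (Some (inr i)) end.
have linL j a v v' : L j (fun i => a * v i + v' i) = a * L j v + L j v'.
  rewrite /L; case: j => [p|i].
    rewrite !mulrDr !mulr_sumr.
    rewrite (eq_bigr (fun i => a * (v (Some (inl i)) * (num (val p i))%:~R) + v' (Some (inl i)) * (num (val p i))%:~R)); last by move=> i _; rewrite mulrDl mulrA.
    rewrite [X in _ + (_ + X) = _](eq_bigr (fun i => a * (v (Some (inr i)) * (if core R Q (grid i) then U (rp p + grid i) else 0)) +
      v' (Some (inr i)) * (if core R Q (grid i) then U (rp p + grid i) else 0))); last by move=> i _; rewrite mulrDl mulrA.
    rewrite !big_split /=; ring.
  case: ifP => // _; have -> : g (fun j => a * v j + v' j) = fun u => a * g v u + g v' u; last exact: quots_linear.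
  apply/funext => u.
  by rewrite /g mulr_sumr -big_split; apply: eq_bigr => j _ /=; rewrite mulrDl mulrA.
have [||v [i0 vi0] vL] := @underdetermined _ _ _ L; first exact: linL.
  rewrite card_sum card_option card_sum card_patterns card_prod !card_ord ltnS leq_add2r //.
have rel t : v None + (\sum_i v (Some (inl i)) * w (t + grid i) + \sum_i v (Some (inr i)) * U (t + grid i)) = 0.
  pose p : {f | f \in pats} := exist (fun f => f \in pats) _ (rect_pattern_in eta n k t).
  rewrite -[RHS](vL (inl p)) /L /=; congr (_ + (_ + _)); apply: eq_bigr => i _.
    by rewrite /w ffunE [t + _]addrC.
  have := vL (inr i); rewrite /L; case: ifP => [ci _|_ ->]; last by rewrite !mul0r.
  have e : rect_pattern eta n k t = rect_pattern eta n k (rp p) by rewrite -rpE.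
  by rewrite ifT //; congr (_ * _); exact: (visU _ ci t (rp p) e).
pose Bp : {poly {poly algC}} := \sum_(i : T) monom (v (Some (inr i))) i.1 i.2.
pose Cp : {poly {poly algC}} := \sum_(i : T) monom (- v (Some (inl i))) i.1 i.2.
pose X1 : {poly {poly algC}} := monom 1 1 0 + monom (- 1) 0 0.
(* The relation moves the translates of [U] to one side, the letters and the constant to the
   other. *)
have BU : pact Bp U = fun t => - v None + pact Cp w t.
  apply/funext => t; rewrite !pact_sum.
  apply/eqP; rewrite -subr_eq0 -[X in _ == X](rel t) opprD opprK; apply/eqP.
  rewrite addrCA; congr (_ + _); rewrite addrC; congr (_ + _).
    by rewrite -sumrN; apply: eq_bigr => i _; rewrite pact_monom mulNr opprK.
  by apply: eq_bigr => i _; rewrite pact_monom.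
have [G G0 annG] := annihilator_intr f0 annf.
have Bp0 : Bp = 0.
  have X10 : X1 != 0.
    exact: monomX_sub1_neq0.
  (* [X1] removes the constant and [G] annihilates [w], so the product annihilates [U] and must be
     zero. *)
  apply/eqP; have : G * X1 * Bp == 0.
    apply/eqP/noann => t.
    have e1 : pact X1 (pact Bp U) = pact X1 (pact Cp w).
      apply/funext => u; rewrite BU !pactD !pact_monom; ring.
    rewrite -mulrA pactM [pact (X1 * _) _]pactM e1 -pactM -pactM mulrC pactM annG; exact: pact_fun0.
  by rewrite !mulf_eq0 (negPf G0) (negPf X10).
have v2 i : v (Some (inr i)) = 0.
  apply/eqP; apply: contraT => nz; have := @sum_monom_neq0 _ n k (fun i => v (Some (inr i))) i nz.
  by rewrite -/Bp Bp0 eqxx.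
have rel2 t : \sum_i v (Some (inl i)) * w (t + grid i) = - v None.
  apply/eqP; rewrite -addr_eq0 addrC -[X in _ == X](rel t) [X in _ == _ + (_ + X)]big1 ?addr0 // => i _.
  by rewrite v2 mul0r.
(* What remains says that [g] maps [w] to a constant, while its quotient vanishes on the core by the
   [inr] equations. *)
have g0 : forall u, g v u = 0.
  apply: (@division_zero _ rs Q Urs R (g v) w bR Rrs _ fw adm3 min3).
  - move=> u; apply: contra_neqT => nR; rewrite /g big1 // => i _.
    case: eqP => [e|_]; last by rewrite mulr0.
    by case/in_rectP: nR; exists i.
  - apply: eq_ind (doubly_per_const (- v None)) _ _; apply/funext => t.
    by rewrite /conv big_map big_enum -(rel2 t); apply: eq_bigr => i _; rewrite gE.
  move=> u cu; have /in_rectP[i ui] : in_rect n k u by apply: core_sub cu.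
  by have := vL (inr i); rewrite /L -ui cu.
have v1 i : v (Some (inl i)) = 0 by rewrite -gE g0.
have vN : v None = 0.
  by apply/eqP; rewrite -oppr_eq0 -(rel2 0) big1 // => i _; rewrite v1 mul0r.
by case: i0 vi0 => [[i|i]|]; rewrite ?v1 ?v2 ?vN eqxx.
Qed.

End Nivat.

Local Close Scope ring_scope.
Unset Implicit Arguments.
Set Strict Implicit.
Set Printing Implicit Defensive.

Theorem theorem1p1 (A : finType) (eta : int * int -> A)
    (hP : exists n : nat, 0 < n /\ rect_complexity eta n 3 <= 3 * n) :
  periodic eta.
Proof.
case: hP => n [_ low]; apply: (@low_complexity_periodic A eta n 3).
by rewrite mulnC.
Qed.
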